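(* For every $D<\infty$ there exists a constant $C=C(D)$ such that for every connected infinite penny graph $G=(V,E,F)$ with $\deg(\sigma)\le D$ for all $\sigma\in F$, every $x\in V$, every $R\ge1$, and every positive harmonic function $f$ on $B_{2R}(x)$, $$\sup_{B_R(x)}f\le C\inf_{B_R(x)}f.$$
   Context: Penny graphs: Let $\{B_i\}_{i=1}^\infty$ be a collection of pairwise disjoint open disks of radius $\frac12$ in $\mathbb{R}^2$, with boundary circles $C_i$ and centers $c_i$. Let $V=\{v_i\}_{i=1}^\infty$, and let $\{v_i,v_j\}\in E$ ($i\ne j$) iff $C_i$ and $C_j$ are tangent, i.e. $|c_i-c_j|=1$. The embedding $\phi$ is given by $\phi(v_i)=c_i$, $\phi(\{v_i,v_j\})=\overline{c_ic_j}$ (the straight segment). The set $F$ of faces corresponds to the connected components of the complement in $\mathbb{R}^2$ of the embedded image of $(V,E)$; for $\sigma\in F$, $\phi(\sigma)$ denotes the corresponding component. The facial degree $\deg(\sigma)\in\mathbb{N}\cup\{\infty\}$ is the number of interior angles (corners at embedded vertices, counted with multiplicity) of the polygonal domain $\phi(\sigma)$. The triple $G=(V,E,F)$ is called an infinite penny graph; it is connected if the graph $(V,E)$ is connected. $d$ is the combinatorial (shortest path) distance on $(V,E)$ and $B_R(x)=\{y\in V: d(y,x)\le R\}$. For $\Omega\subset V$, let $\delta\Omega=\{y\in V\setminus\Omega:\exists x\in\Omega,\ y\sim x\}$ and $\overline\Omega=\Omega\cup\delta\Omega$. For $f:\overline\Omega\to\mathbb{R}$ and $x\in\Omega$, $\Delta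 f(x)=\sum_{y\sim x}(f(y)-f(x))$, the sum being over neighbors $y$ of $x$. A positive harmonic function on $\Omega$ is a function $f:\overline\Omega\to\mathbb{R}$ with $\Delta f=0$ on $\Omega$ and $f>0$ on $\Omega$. *)

(* Defs.v *)
From HB Require Import structures.
From mathcomp Require Export all_boot all_order all_algebra.
From mathcomp Require Export all_classical all_reals all_analysis.
Export numFieldNormedType.Exports.

Set Implicit Arguments.
Unset Strict Implicit.
Unset Printing Implicit Defensive.

Import Order.TTheory GRing.Theory Num.Theory.

Local Open Scope classical_set_scope.
Local Open Scope ring_scope.

(* The library norm on R * R is the sup norm: it induces the usual topology of
   the plane, but Euclidean lengths have to be introduced by hand. *)
Definition edist (R : realType) (p q : R * R) : R :=
  Num.sqrt ((p.1 - q.1) ^+ 2 + (p.2 - q.2) ^+ 2).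

Definition disk (R : realType) (a : R * R) : set (R * R) :=
  [set p | edist a p < 2^-1].

Definition segment (R : realType) (a b : R * R) : set (R * R) :=
  [set (1 - t) *: a + t *: b | t in `[0, 1]%classic].

(* A penny graph is given by its sequence of disk centers; the vertex v_i is
   identified with its index i : nat. *)
Definition is_penny (R : realType) (c : nat -> R * R) : Prop :=
  trivIset [set: nat] (fun i => disk (c i)).

Definition adj (R : realType) (c : nat -> R * R) : rel nat :=
  fun i j => (i != j) && (edist (c i) (c j) == 1).

(* walk_of_length c x y n: some walk x = z_0 ~ z_1 ~ ... ~ z_n = y. *)
Definition walk_of_length (R : realType) (c : nat -> R * R) (x y n : nat) :
    Prop :=
  exists s : seq nat, [/\ path (adj c) x s, last x s = y & size s = n].

Definition graph_connected (R : realType) (c : nat -> R * R) : Prop :=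
  forall x y, exists n, walk_of_length c x y n.

Definition gdist (R : realType) (c : nat -> R * R) (x y : nat) : \bar R :=
  ereal_inf [set (n%:R : R)%:E | n in walk_of_length c x y].

Definition gball (R : realType) (c : nat -> R * R) (x : nat) (r : R) :
    set nat :=
  [set y | (gdist c y x <= r%:E)%E].

Definition embedded_graph (R : realType) (c : nat -> R * R) : set (R * R) :=
  range c `|`
  \bigcup_(e in [set e : nat * nat | adj c e.1 e.2]) segment (c e.1) (c e.2).

Definition faces (R : realType) (c : nat -> R * R) : set (set (R * R)) :=
  [set connected_component (~` embedded_graph c) p
    | p in ~` embedded_graph c].

(* Corners of the domain S, as pairs (i, U) with U the trace of one interior
   angle on the disk at c_i.  Since distinct centers are at distance at least
   1, this open disk of radius 1/2 meets no edge other than those incident to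
   v_i, so those edges cut it into open circular sectors, one for each angle
   between consecutive edges (a slit disk, of angle 2 pi, if there is only one
   edge).  A face that returns to v_i through several sectors has several
   corners there, which is the multiplicity in the facial degree. *)
Definition corners (R : realType) (c : nat -> R * R) (S : set (R * R)) :
    set (nat * set (R * R)) :=
  [set iU | exists2 p, (S `&` disk (c iU.1)) p &
              iU.2 = connected_component (S `&` disk (c iU.1)) p].

(* Equal to +oo if there are infinitely many corners. *)
Definition facial_degree (R : realType) (c : nat -> R * R)
    (S : set (R * R)) : \bar R :=
  counting (corners c S).

(* The neighbor set of a vertex of a penny graph is finite (disjointness of the
   disks leaves room for at most six), so this is the sum over all neighbors. *)
Definition laplacian (R : realType) (c : nat -> R * R) (f : nat -> R)
    (x : nat) : R :=
  \sum_(y \in [set y | adj c x y]) (f y - f x).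

(* A function on the closure of Omega is represented by an arbitrary extension
   to all vertices; only its values on the closure of Omega are involved. *)
Definition positive_harmonic (R : realType) (c : nat -> R * R)
    (Omega : set nat) (f : nat -> R) : Prop :=
  forall x, Omega x -> laplacian c f x = 0 /\ 0 < f x.

(* Main.v *)
Require Import Defs.
From mathcomp Require Import ring lra zify.

Set Implicit Arguments.
Unset Strict Implicit.
Unset Printing Implicit Defensive.

Import Order.TTheory GRing.Theory Num.Theory.

Local Open Scope classical_set_scope.
Local Open Scope ring_scope.

(** The vertices of a face [S] of bounded degree are pairwise close in the
    graph: a penny graph is connected, so a partition of the vertices of [S]
    without edges across would split the boundary of [S] into two pieces at
    positive distance, and a loop crossing one of them exactly once would
    contradict the simple connectedness of the plane.  Hence faces have bounded
    diameter, every segment can be followed by a nearby walk in the graph, and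
    the graph distance is comparable to the distance in the plane.

    For a positive harmonic function [f], testing the equation against [g^2 / f]
    bounds the Dirichlet energy of [log f] by that of the cutoff [g], which is
    bounded since a square of side [n] contains [O(n^2)] pennies.  Averaging over
    the square annuli of bounded width with radii between [n] and [2 n], one of
    them has bounded total variation of [log f]; its vertices can be joined
    nearby, and the maximum principle compares the values of [f] in the square of
    radius [n] with its values on this annulus. *)

(** * Chains in the plane *)

Section Plane.
Variable R : realType.
Local Notation pt := (R * R)%type.

(** The squared Euclidean distance keeps all estimates polynomial; [|p - q|] always denotes the sup
    norm. *)
Definition sqd (p q : pt) : R := (p.1 - q.1) ^+ 2 + (p.2 - q.2) ^+ 2.

Definition lerp (a b : pt) (t : R) : pt := (1 - t) *: a + t *: b.

Lemma lerpE1 a b t : (lerp a b t).1 = (1 - t) * a.1 + t * b.1.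
Proof. by []. Qed.

Lemma lerpE2 a b t : (lerp a b t).2 = (1 - t) * a.2 + t * b.2.
Proof. by []. Qed.

Lemma pt_eq (p q : pt) : p.1 = q.1 -> p.2 = q.2 -> p = q.
Proof. by case: p q => ? ? [? ?] /= -> ->. Qed.

Lemma lerp0 a b : lerp a b 0 = a.
Proof. by apply: pt_eq; rewrite ?lerpE1 ?lerpE2; ring. Qed.

Lemma lerp1 a b : lerp a b 1 = b.
Proof. by apply: pt_eq; rewrite ?lerpE1 ?lerpE2; ring. Qed.

Lemma lerpC a b t : lerp a b t = lerp b a (1 - t).
Proof. by apply: pt_eq; rewrite ?lerpE1 ?lerpE2; ring. Qed.

Lemma sqdC p q : sqd p q = sqd q p.
Proof. by rewrite /sqd; ring. Qed.

Lemma sqd_ge0 p q : 0 <= sqd p q.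
Proof. by rewrite addr_ge0 ?sqr_ge0. Qed.

Lemma sqdxx p : sqd p p = 0.
Proof. by rewrite /sqd !subrr expr0n addr0. Qed.

Lemma edist_lt p q e : 0 <= e -> (edist p q < e) = (sqd p q < e ^+ 2).
Proof.
move=> e0; rewrite /edist -/(sqd p q).
rewrite -(@ltr_pXn2r _ 2) ?nnegrE ?sqrtr_ge0 //.
by rewrite sqr_sqrtr ?sqd_ge0.
Qed.

Lemma edist_eq1 p q : edist p q = 1 <-> sqd p q = 1.
Proof.
rewrite /edist -/(sqd p q); split=> [h|->]; last by rewrite sqrtr1.
by rewrite -(sqr_sqrtr (sqd_ge0 p q)) h expr1n.
Qed.

Lemma normlt (p : pt) e : `|p| < e <-> `|p.1| < e /\ `|p.2| < e.
Proof. by rewrite prod_normE gt_max; split=> [/andP//|[-> ->]]. Qed.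

Lemma normle (p : pt) e : `|p| <= e <-> `|p.1| <= e /\ `|p.2| <= e.
Proof. by rewrite prod_normE ge_max; split=> [/andP//|[-> ->]]. Qed.

Lemma norm_sqd_lt p q e : `|p - q| < e -> sqd p q < 2 * e ^+ 2.
Proof.
move=> pq; have e0 : 0 <= e by apply: le_trans (ltW pq).
move: pq => /normlt[/= a b]; rewrite /sqd.
have : (p.1 - q.1) ^+ 2 < e ^+ 2.
  by rewrite -real_normK ?num_real // ltr_pXn2r ?nnegrE.
have : (p.2 - q.2) ^+ 2 < e ^+ 2.
  by rewrite -real_normK ?num_real // ltr_pXn2r ?nnegrE.
lra.
Qed.

Lemma sqd_norm_le p q e : 0 <= e -> sqd p q <= e ^+ 2 -> `|p - q| <= e.
Proof.
move=> e0; rewrite /sqd => h; apply/normle; split => /=;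
  rewrite -(@ler_pXn2r _ 2) ?nnegrE // real_normK ?num_real //.
- by apply: le_trans h; rewrite lerDl sqr_ge0.
- by apply: le_trans h; rewrite lerDr sqr_ge0.
Qed.

(** Stewart's identity for two segments: the gap estimates below then need only lower bounds on the
    distances between the ends. *)
Lemma sqd_lerp a b c d t s :
  sqd (lerp a b t) (lerp c d s) =
  (1 - t) * (1 - s) * sqd a c + (1 - t) * s * sqd a d
  + t * (1 - s) * sqd b c + t * s * sqd b d
  - t * (1 - t) * sqd a b - s * (1 - s) * sqd c d.
Proof. by rewrite /sqd !lerpE1 !lerpE2; ring. Qed.

Lemma norm_lerp_l a b t : 0 <= t -> t <= 1 -> `|a - lerp a b t| <= `|a - b|.
Proof.
move=> t0 t1; have -> : a - lerp a b t = t *: (a - b).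
  apply: pt_eq => /=; rewrite ?lerpE1 ?lerpE2 /=.
    by rewrite /GRing.scale /=; ring.
  by rewrite /GRing.scale /=; ring.
rewrite prod_norm_scale ger0_norm //.
by rewrite -[leRHS]mul1r ler_wpM2r.
Qed.

Lemma norm_lerp_le p q z e : `|p - z| <= e -> `|q - z| <= e ->
  forall t, 0 <= t -> t <= 1 -> `|lerp p q t - z| <= e.
Proof.
move=> pe qe t t0 t1.
have -> : lerp p q t - z = (1 - t) *: (p - z) + t *: (q - z).
  by apply: pt_eq => /=; rewrite ?lerpE1 ?lerpE2 /= /GRing.scale /=; ring.
apply: le_trans (ler_normD _ _) _; rewrite !prod_norm_scale.
rewrite !ger0_norm //; last by lra.
have h1 : t * `|q - z| <= t * e by rewrite ler_wpM2l.
have h2 : (1 - t) * `|p - z| <= (1 - t) * e by rewrite ler_wpM2l //; lra.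
lra.
Qed.

Lemma segP (a b z : pt) :
  segment a b z <-> exists2 t, 0 <= t <= 1 & z = lerp a b t.
Proof.
split=> [[t /= + <-]|[t h ->]]; first by rewrite in_itv /=; exists t.
by exists t; rewrite //= in_itv.
Qed.

Lemma seg_l (a b : pt) : segment a b a.
Proof. by apply/segP; exists 0; rewrite ?lexx ?ler01 ?lerp0. Qed.

Lemma seg_r (a b : pt) : segment a b b.
Proof. by apply/segP; exists 1; rewrite ?lexx ?ler01 ?lerp1. Qed.

Lemma segC (a b : pt) : segment a b `<=` segment b a.
Proof.
move=> z /segP[t /andP[t0 t1] ->]; apply/segP; exists (1 - t).
  by apply/andP; split; lra.
exact: lerpC.
Qed.

Lemma seg_sub (a b u v : pt) : segment a b u -> segment a b v ->
  segment u v `<=` segment a b.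
Proof.
move=> /segP[t /andP[t0 t1] ->] /segP[s /andP[s0 s1] ->] z.
move=> /segP[w /andP[w0 w1] ->]; apply/segP; exists ((1 - w) * t + w * s).
  apply/andP; split; first by rewrite addr_ge0 ?mulr_ge0 //; lra.
  have : (1 - w) * t <= (1 - w) by rewrite ler_piMr //; lra.
  have : w * s <= w by rewrite ler_piMr.
  lra.
by apply: pt_eq; rewrite !(lerpE1, lerpE2); ring.
Qed.

Lemma seg_convex_le (p q z w : pt) e : `|p - z| <= e -> `|q - z| <= e ->
  segment p q w -> `|w - z| <= e.
Proof. by move=> pe qe /segP[t /andP[t0 t1] ->]; apply: norm_lerp_le. Qed.

Lemma seg_sqd_lt (p q z w : pt) e : 0 <= e -> sqd p z < e -> sqd q z < e ->
  segment p q w -> sqd w z < e.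
Proof.
move=> e0 pe qe /segP[t /andP[t0 t1] ->].
have := sqd_lerp p q z z t 0; rewrite lerp0 => ->.
rewrite sqdxx; have := sqd_ge0 p q => pq0.
have : 0 <= t * (1 - t) * sqd p q by rewrite !mulr_ge0 //; lra.
have [->|tn] := eqVneq t 0; first by lra.
have tp : 0 < t by rewrite lt_neqAle eq_sym tn.
have h1 : t * sqd q z < t * e by rewrite ltr_pM2l.
have h2 : (1 - t) * sqd p z <= (1 - t) * e.
  by apply: ler_wpM2l; [lra|exact: ltW].
lra.
Qed.

Lemma seg_connected (a b : pt) : connected (segment a b).
Proof.
apply: connected_continuous_connected; first exact: segment_connected.
apply: continuous_subspaceT => t.
apply: cvgD; apply: cvgZr_tmp; last exact: cvg_id.
by apply: cvgB; [exact: cvg_cst|exact: cvg_id].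
Qed.

(** Discrete paths in [A] with jumps smaller than [e], used in place of continuous curves. *)
Inductive chain (e : R) (A : set pt) (p : pt) : pt -> Prop :=
| chain0 : A p -> chain e A p p
| chainS q r : chain e A p q -> A r -> `|q - r| < e -> chain e A p r.

Lemma chain_l e A p q : chain e A p q -> A p.
Proof. by elim. Qed.

Lemma chain_r e A p q : chain e A p q -> A q.
Proof. by case. Qed.

Lemma chain_sub e A B p q : A `<=` B -> chain e A p q -> chain e B p q.
Proof.
move=> AB; elim=> [/AB|q' r _ IH /AB Br qr]; first exact: chain0.
exact: chainS IH Br qr.
Qed.

Lemma chain_trans e A p q r : chain e A p q -> chain e A q r -> chain e A p r.
Proof.
move=> pq; elim=> [//|q' r' _ IH Ar qr]; exact: chainS IH Ar qr.
Qed.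

Lemma chain_sym e A p q : chain e A p q -> chain e A q p.
Proof.
elim=> [|q' r pq IH Ar qr]; first exact: chain0.
apply: chain_trans IH; apply: chainS (chain0 _ Ar) (chain_r pq) _.
by rewrite distrC.
Qed.

(** A chain visits finitely many points. The bound is needed because the potential of a cocycle is
    built on a bounded square. *)
Lemma chain_bounded e A p q : chain e A p q ->
  exists M, forall M', M <= M' -> chain e (A `&` [set z | `|z| <= M']) p q.
Proof.
elim=> [Ap|q' r _ [M IH] Ar qr].
  by exists `|p| => M' h; apply: chain0.
exists (Num.max M `|r|) => M'; rewrite ge_max => /andP[h1 h2].
exact: chainS (IH _ h1) _ qr.
Qed.

Lemma open_fattening e (B : set pt) :
  open [set w | exists2 z, B z & `|z - w| < e].
Proof.
have -> : [set w | exists2 z, B z & `|z - w| < e] = \bigcup_(z in B) ball z e.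
  by apply/seteqP; split => w [z Bz h]; exists z => //;
    move: h; rewrite prod_norm_ball.
by apply: bigcup_open => z _; apply: ball_open.
Qed.

(** The points of [A] reached from [p] form a relatively open and closed subset: neither its
    [e]-fattening nor that of its complement crosses over. *)
Lemma connected_chain e (A : set pt) p q : 0 < e ->
  connected A -> A p -> A q -> chain e A p q.
Proof.
move=> e0 cA Ap Aq; pose B := [set z | chain e A p z].
suff BA : B = A by move: Aq; rewrite -{1}BA.
apply: cA; first by exists p; apply: chain0.
- exists [set w | exists2 z, B z & `|z - w| < e]; first exact: open_fattening.
  apply/seteqP; split=> [w Bw|w [Aw [z Bz zw]]]; last exact: chainS Bz Aw zw.
  by split; [exact: chain_r Bw|exists w; rewrite // subrr normr0].
- exists (~` [set w | exists2 z, (A `\` B) z & `|z - w| < e]).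
    exact/open_closedC/open_fattening.
  apply/seteqP; split=> [w Bw|w [Aw /= h]].
    split; first exact: chain_r Bw.
    by case=> z [Az nBz] zw; apply: nBz; apply: chainS Bw Az _; rewrite distrC.
  by apply: contrapT => nBw; apply: h; exists w; rewrite // subrr normr0.
Qed.

Lemma chain_seg e (p q : pt) : 0 < e -> chain e (segment p q) p q.
Proof.
move=> e0; apply: connected_chain => //; first exact: seg_connected.
  exact: seg_l.
exact: seg_r.
Qed.

Lemma chain_change e A p q (P : set pt) : chain e A p q -> P p -> ~ P q ->
  exists z z', [/\ A z, A z', P z, ~ P z' & `|z - z'| < e].
Proof.
elim=> [//|q' r pq IH Ar qr Pp nPr].
have [Pq'|nPq'] := pselect (P q'); last exact: IH.
by exists q', r; split=> //; exact: chain_r pq.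
Qed.

Lemma chain_inv e A p q (P : set pt) : chain e A p q ->
  (forall z z', A z -> A z' -> `|z - z'| < e -> P z -> P z') -> P p -> P q.
Proof.
move=> ch h Pp; apply: contrapT => nPq.
have [z [z' [Az Az' Pz nPz' zz']]] := chain_change ch Pp nPq.
exact/nPz'/(h z).
Qed.
End Plane.

(** * Distances between vertices and edges of a penny graph *)

Section PennyGeometry.
Variables (R : realType) (c : nat -> R * R).
Hypothesis pen : is_penny c.
Hypothesis conn : graph_connected c.
Local Notation pt := (R * R)%type.
Local Notation Gam := (embedded_graph c).

(** Two centers at distance below 1 would have their midpoint in both disks. *)
Lemma penny_sep i j : i <> j -> 1 <= sqd (c i) (c j).
Proof.
move=> ij; rewrite leNgt; apply/negP => h; apply: ij; apply: (pen I I).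
exists (lerp (c i) (c j) 2^-1); split; rewrite /disk /= edist_lt ?invr_ge0 //.
- rewrite -{1}(lerp0 (c i) (c j)) /sqd !(lerpE1, lerpE2).
  by move: h; rewrite /sqd; lra.
- rewrite -{1}(lerp1 (c i) (c j)) /sqd !(lerpE1, lerpE2).
  by move: h; rewrite /sqd; lra.
Qed.

Lemma adjP a b : adj c a b <-> sqd (c a) (c b) = 1.
Proof.
rewrite /adj; split=> [/andP[_ /eqP/edist_eq1]//|h].
apply/andP; split; last by apply/eqP/edist_eq1.
by apply/eqP => e; move: h; rewrite e sqdxx => /eqP; rewrite eq_sym oner_eq0.
Qed.

Lemma adjC a b : adj c a b = adj c b a.
Proof. by apply/idP/idP => /adjP h; apply/adjP; rewrite sqdC. Qed.

Lemma adj_norm a b : adj c a b -> `|c a - c b| <= 1.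
Proof. by move=> /adjP h; apply: sqd_norm_le; rewrite // h expr1n. Qed.

(** A walk from [a] to a different vertex, here [a.+1], starts with an edge. Hence every point of
    the graph lies on an edge. *)
Lemma adj_ex a : exists b, adj c a b.
Proof.
have [n [s]] := conn a a.+1.
case: s => [[_ /= e _]|b s [/= /andP[h _] _ _]]; last by exists b.
by move: (n_Sn a); rewrite -e.
Qed.

Definition edge_pt (q : pt) a b (t : R) : Prop :=
  [/\ adj c a b, 0 <= t, t <= 1 & q = lerp (c a) (c b) t].

Lemma edge_pt_sym q a b t : edge_pt q a b t -> edge_pt q b a (1 - t).
Proof.
by move=> [ab t0 t1 ->]; split; rewrite 1?adjC //; [lra|lra|exact: lerpC].
Qed.

Lemma edge_pt_vertex a b : adj c a b -> edge_pt (c a) a b 0.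
Proof. by move=> ab; split; rewrite ?lerp0. Qed.

Lemma GamP q : Gam q <-> exists a b t, edge_pt q a b t.
Proof.
split=> [[[a _ <-]|[[a b] /= ab /segP[t /andP[t0 t1] ->]]]|].
- by have [b ab] := adj_ex a; exists a, b, 0; apply: edge_pt_vertex.
- by exists a, b, t.
- case=> a [b [t [ab t0 t1 ->]]]; right; exists (a, b) => //=.
  by apply/segP; exists t; rewrite ?t0.
Qed.

Lemma Gam_vertex a : Gam (c a).
Proof. by left; exists a. Qed.

Lemma GamP_near q : Gam q -> exists a b t, edge_pt q a b t /\ t <= 2^-1.
Proof.
move=> /GamP[a [b [t h]]]; have [th|th] := lerP t 2^-1; first by exists a, b, t.
by exists b, a, (1 - t); split; [exact: edge_pt_sym|lra].
Qed.

Lemma edge_pt_norm q a b t : edge_pt q a b t -> `|q - c a| <= t.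
Proof.
move=> [/adjP ab t0 t1 ->]; apply: sqd_norm_le => //.
have -> : sqd (lerp (c a) (c b) t) (c a) = t ^+ 2 * sqd (c a) (c b).
  by rewrite /sqd !(lerpE1, lerpE2); ring.
by rewrite ab mulr1.
Qed.

(** Only [b] and [b'] may coincide; the other three pairs of ends are at distance at least 1. This
    leaves [1 - t - s - t s + t^2 + s^2], whose least value 0.2025 is taken at [t = s = 11/20]. *)
Lemma gap_near q q' a b a' b' t s : edge_pt q a b t -> edge_pt q' a' b' s ->
  t <= 11 / 20 -> s <= 11 / 20 -> a <> a' -> ~ adj c a a' ->
  1 / 5 <= sqd q q'.
Proof.
move=> [ab t0 t1 ->] [ab' s0 s1 ->] t2 s2 aa' naa'.
have h1 := penny_sep aa'.
have h2 : 1 <= sqd (c a) (c b').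
  by apply: penny_sep => e; apply: naa'; rewrite e adjC.
have h3 : 1 <= sqd (c b) (c a').
  by apply: penny_sep => e; apply: naa'; rewrite -e.
have h4 := sqd_ge0 (c b) (c b').
move/adjP: ab => ab; move/adjP: ab' => ab'.
rewrite sqd_lerp ab ab'.
have k1 : 0 <= (1 - t) * (1 - s) * (sqd (c a) (c a') - 1).
  by rewrite !mulr_ge0 //; lra.
have k2 : 0 <= (1 - t) * s * (sqd (c a) (c b') - 1).
  by rewrite !mulr_ge0 //; lra.
have k3 : 0 <= t * (1 - s) * (sqd (c b) (c a') - 1).
  by rewrite !mulr_ge0 //; lra.
have k4 : 0 <= t * s * sqd (c b) (c b') by rewrite !mulr_ge0 //; lra.
have k5 : 0 <= (t - s) ^+ 2 by apply: sqr_ge0.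
have k6 : 0 <= (11/20 - t) * (11/20 - s) by rewrite mulr_ge0; lra.
rewrite !expr2 in k5; nra.
Qed.

(** All four pairs of ends are at distance at least 1, which leaves [1 - t (1 - t) - s (1 - s)],
    least at the two midpoints. *)
Lemma gap_far q q' a b a' b' t s : edge_pt q a b t -> edge_pt q' a' b' s ->
  a <> a' -> a <> b' -> b <> a' -> b <> b' -> 1 / 2 <= sqd q q'.
Proof.
move=> [ab t0 t1 ->] [ab' s0 s1 ->] h1 h2 h3 h4.
have {}h1 := penny_sep h1; have {}h2 := penny_sep h2.
have {}h3 := penny_sep h3; have {}h4 := penny_sep h4.
move/adjP: ab => ab; move/adjP: ab' => ab'.
rewrite sqd_lerp ab ab'.
have k1 : 0 <= (1 - t) * (1 - s) * (sqd (c a) (c a') - 1).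
  by rewrite !mulr_ge0 //; lra.
have k2 : 0 <= (1 - t) * s * (sqd (c a) (c b') - 1).
  by rewrite !mulr_ge0 //; lra.
have k3 : 0 <= t * (1 - s) * (sqd (c b) (c a') - 1).
  by rewrite !mulr_ge0 //; lra.
have k4 : 0 <= t * s * (sqd (c b) (c b') - 1) by rewrite !mulr_ge0 //; lra.
have k5 : 0 <= (t - 1/2) ^+ 2 by apply: sqr_ge0.
have k6 : 0 <= (s - 1/2) ^+ 2 by apply: sqr_ge0.
rewrite !expr2 in k5 k6; lra.
Qed.

(** Two edges at a vertex form an angle of at least 60 degrees, so a point at distance [t] from the
    vertex is at distance at least [t sin 60] from the other edge. *)
Lemma gap_corner q q' a b b' t s : edge_pt q a b t -> edge_pt q' a b' s ->
  b <> b' -> 3 / 4 * t ^+ 2 <= sqd q q'.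
Proof.
move=> [ab t0 t1 ->] [ab' s0 s1 ->] h4.
have {}h4 := penny_sep h4.
move/adjP: ab => ab; move/adjP: ab' => ab'.
rewrite sqd_lerp ab ab' sqdxx (sqdC (c b)) ab.
have k4 : 0 <= t * s * (sqd (c b) (c b') - 1) by rewrite !mulr_ge0 //; lra.
have k6 : 0 <= (s - t/2) ^+ 2 by apply: sqr_ge0.
rewrite !expr2 in k6 *; lra.
Qed.

(** The extreme case is the height of the unit equilateral triangle. *)
Lemma vertex_edge_far v q a b t : edge_pt q a b t -> v <> a -> v <> b ->
  3 / 4 <= sqd q (c v).
Proof.
move=> [ab t0 t1 ->] h1 h2.
have {}h1 := penny_sep h1; have {}h2 := penny_sep h2.
have := sqd_lerp (c a) (c b) (c v) (c v) t 0; rewrite lerp0 => ->.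
move/adjP: ab => ab; rewrite sqdxx ab !(sqdC _ (c v)).
have k1 : 0 <= (1 - t) * (sqd (c v) (c a) - 1) by rewrite !mulr_ge0 //; lra.
have k2 : 0 <= t * (sqd (c v) (c b) - 1) by rewrite !mulr_ge0 //; lra.
have k5 : 0 <= (t - 1/2) ^+ 2 by apply: sqr_ge0.
rewrite !expr2 in k5; lra.
Qed.

End PennyGeometry.

(** * Faces and their vertices *)

Section Faces.
Variables (R : realType) (c : nat -> R * R).
Hypothesis pen : is_penny c.
Hypothesis conn : graph_connected c.
Local Notation pt := (R * R)%type.
Local Notation Gam := (embedded_graph c).

(** The disks are those of [corners], so that each vertex of [S] carries at least one corner. *)
Definition face_vertices (S : set pt) : set nat :=
  [set v | (S `&` disk (c v)) !=set0].
Local Notation W := face_vertices.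

(** A weighted Young inequality, serving as triangle inequality for squared distances when [r] is
    close to [q]. *)
Lemma sqd_trans (p q r : pt) : sqd p r <= 11 / 10 * sqd p q + 11 * sqd q r.
Proof.
have k (x y : R) : (x + y) ^+ 2 <= 11 / 10 * x ^+ 2 + 11 * y ^+ 2.
  by have := sqr_ge0 (x - 10 * y); rewrite !expr2; lra.
have := k (p.1 - q.1) (q.1 - r.1); have := k (p.2 - q.2) (q.2 - r.2).
by rewrite /sqd !addrA !subrK; lra.
Qed.

Lemma diskE v p : disk (c v) p <-> sqd (c v) p < 1 / 4.
Proof.
rewrite /disk /= edist_lt ?invr_ge0 //.
by rewrite (_ : 2^-1 ^+ 2 = 1 / 4 :> R) //; field.
Qed.

Lemma face_sub S p : faces c S -> S p -> ~ Gam p.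
Proof. by move=> [p0 _ <-] /connected_component_sub. Qed.

Lemma face_connected_set S : faces c S -> connected S.
Proof. by move=> [p0 _ <-]; exact: component_connected. Qed.

Lemma face_seg S p q : faces c S -> S p -> segment p q `&` Gam = set0 -> S q.
Proof.
move=> [p0 _ <-] Sp sG; apply: connected_component_trans Sp _.
apply: (@connected_component_max _ _ (segment p q)).
- exact: seg_l.
- by move=> z h Gz; have : (segment p q `&` Gam) z by []; rewrite sG.
- exact: seg_connected.
- exact: seg_r.
Qed.

(** An edge sharing one end stays away by [gap_corner], as [3/4 (9/20)^2 > 3/20], and a disjoint
    edge by [gap_far]. *)
Lemma edge_pt_mid q q' a b a' b' t t' : edge_pt c q a b t ->
  edge_pt c q' a' b' t' -> 9 / 20 <= t -> t <= 11 / 20 ->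
  sqd q q' < 3 / 20 -> a' = a /\ b' = b \/ a' = b /\ b' = a.
Proof.
move=> E E' t1 t2 d.
have sq1 : (9 / 20) ^+ 2 <= t ^+ 2 by rewrite ler_pXn2r ?nnegrE //; lra.
have sq2 : (9 / 20) ^+ 2 <= (1 - t) ^+ 2 by rewrite ler_pXn2r ?nnegrE //; lra.
have Es := edge_pt_sym E; have Es' := edge_pt_sym E'.
rewrite !expr2 in sq1 sq2.
have [aa|aa] := eqVneq a' a; last have [ab|ab] := eqVneq a' b.
- subst a'; have [bb|/eqP bb] := eqVneq b' b; first by left.
  by exfalso; have := gap_corner pen E E' (nesym bb); rewrite expr2; lra.
- subst a'; have [ba|/eqP ba] := eqVneq b' a; first by right.
  by exfalso; have := gap_corner pen Es E' (nesym ba); rewrite expr2; lra.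
- move/eqP in aa; move/eqP in ab; have [ba|ba] := eqVneq b' a.
    exfalso; subst b'.
    by have := gap_corner pen E Es' (nesym ab); rewrite expr2; lra.
  have [bb|bb] := eqVneq b' b.
    exfalso; subst b'.
    by have := gap_corner pen Es Es' (nesym aa); rewrite expr2; lra.
  move/eqP in ba; move/eqP in bb.
  exfalso.
  have := gap_far pen E E' (nesym aa) (nesym ba) (nesym ab) (nesym bb); lra.
Qed.

Lemma seg_dist (p q z : pt) : segment p q z -> `|p - z| <= `|p - q|.
Proof. by move=> /segP[t /andP[t0 t1] ->]; apply: norm_lerp_l. Qed.

(* A point of [S] close to the midpoint of an edge may lie in neither of the
   two disks at its ends; sliding it a little towards one end crosses no edge,
   since only this edge comes near the midpoint. *)
Lemma face_near S p p' : faces c S -> S p -> ~ S p' -> `|p - p'| < 1 / 50 ->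
  exists q a b t,
    [/\ edge_pt c q a b t, t <= 11 / 20, segment p p' q & W S a].
Proof.
move=> fS Sp nSp' pp'.
have [q [pq Gq]] : (segment p p' `&` Gam) !=set0.
  by apply/set0P/eqP => h; apply: nSp'; exact: face_seg Sp h.
have [a [b [t [E t2]]]] := GamP_near conn Gq.
have qp : sqd q p < 2 * (1 / 50) ^+ 2.
  by rewrite sqdC; apply: norm_sqd_lt; apply: le_lt_trans (seg_dist pq) _.
rewrite expr2 in qp.
have qa : sqd (c a) q = t ^+ 2.
  case: E => /adjP ab _ _ ->; rewrite -[RHS]mulr1 -ab /sqd !(lerpE1, lerpE2).
  by ring.
have t0 : 0 <= t by case: E.
have ap := sqd_trans (c a) q p; rewrite qa in ap.
exists q, a, b, t; split=> //; first by lra.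
(* Away from the midpoint, [p] itself already lies in the disk at [a]. *)
have [t9|t9] := ltrP t (9 / 20).
  have : t ^+ 2 <= (9 / 20) ^+ 2 by rewrite ler_pXn2r ?nnegrE //; lra.
  rewrite expr2 [leRHS]expr2 => tt.
  by exists p; split=> //; apply/diskE; rewrite expr2 in ap; lra.
have tt : t ^+ 2 <= (1 / 2) ^+ 2 by rewrite ler_pXn2r ?nnegrE //; lra.
rewrite [leRHS]expr2 in tt.
have lp (w : R) : sqd (c a) (lerp p (c a) w) = (1 - w) ^+ 2 * sqd (c a) p.
  by rewrite /sqd !(lerpE1, lerpE2); ring.
(* Sliding [p] by one fifth of the way to [c a] multiplies the squared distance by 16/25, enough to
   enter the disk. *)
exists (lerp p (c a) (1 / 5)); split; last first.
  apply/diskE; rewrite lp (_ : (1 - 1 / 5) ^+ 2 = 16 / 25); last by field.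
  lra.
apply: (face_seg fS Sp); apply/seteqP; split=> // q' [q's Gq'].
have {q's} [w /andP[w0 w1] q'E] : exists2 w, 0 <= w <= 1 / 5 &
    q' = lerp p (c a) w.
  move: q's => /segP[w /andP[w0 w1] ->]; exists (w / 5).
    by apply/andP; lra.
  by apply: pt_eq; rewrite !(lerpE1, lerpE2); field.
have ww : w ^+ 2 <= (1 / 5) ^+ 2 by rewrite ler_pXn2r ?nnegrE //; lra.
have pq' : sqd p q' = w ^+ 2 * sqd (c a) p.
  by rewrite q'E /sqd !(lerpE1, lerpE2); ring.
have pa0 := sqd_ge0 (c a) p.
have : sqd p q' <= 1 / 25 * sqd (c a) p.
  rewrite pq'; apply: ler_wpM2r => //; apply: le_trans ww _.
  by rewrite expr2; lra.
have := sqd_trans q' p q; rewrite (sqdC q' p) (sqdC p q) => k1 k2.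
have [a' [b' [t' E']]] := (GamP conn q').1 Gq'.
have k3 : a' = a /\ b' = b \/ a' = b /\ b' = a.
  by apply: (edge_pt_mid E E' t9); [|rewrite sqdC]; lra.
have [t1 [t10 t11 q'E1]] : exists t1, [/\ 0 <= t1, t1 <= 1 &
    q' = lerp (c a) (c b) t1].
  case: (edge_pt_sym E') => _ s0 s1 sE; case: E' => _ r0 r1 rE.
  case: k3 => -[e1 e2]; rewrite ?e1 ?e2 in sE rE.
    by exists t'.
  by exists (1 - t').
have w1' : 0 < 1 - w by lra.
apply: (face_sub fS Sp); apply/(GamP conn); exists a, b, (t1 / (1 - w)).
(* The slide is directed at [c a], so a point of the edge on it puts [p] on the line of that edge,
   and on the edge itself since [p] is closer than 1 to [c a]. *)
have pE : p = lerp (c a) (c b) (t1 / (1 - w)).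
  move: q'E1; rewrite q'E => e; have wn : 1 - w != 0 by rewrite gt_eqF.
  have : t1 = t1 / (1 - w) * (1 - w) by rewrite divfK.
  move: (t1 / (1 - w)) e => u /[swap] ->.
  move=> e; move: (congr1 fst e) (congr1 snd e).
  rewrite !(lerpE1, lerpE2) => e1 e2.
  by apply: pt_eq; rewrite !(lerpE1, lerpE2); apply: (mulfI wn); lra.
case: E => ab _ _ _; split=> //; first by rewrite divr_ge0 // ltW.
rewrite leNgt; apply/negP => g1.
have : 1 < (t1 / (1 - w)) ^+ 2 by rewrite expr_gt1 //; lra.
have -> : (t1 / (1 - w)) ^+ 2 = sqd (c a) p.
  rewrite [in RHS]pE -[LHS]mulr1; move/adjP: ab => <-.
  by move: (t1 / _) => u; rewrite /sqd !(lerpE1, lerpE2); ring.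
lra.
Qed.

Lemma Gam_chain e q q' : 0 < e -> Gam q -> Gam q' -> chain e Gam q q'.
Proof.
move=> e0.
have es a b : adj c a b -> segment (c a) (c b) `<=` Gam.
  by move=> ab z h; right; exists (a, b).
have vv a b : chain e Gam (c a) (c b).
  have [n [s [+ <- _]]] := conn a b.
  elim: s a => [|a' s IH] a /=.
    by move=> _; apply: chain0; left; exists a.
  move=> /andP[aa' /IH]; apply: chain_trans.
  by apply: chain_sub (chain_seg _ _ e0); exact: es.
have vq p : Gam p -> exists a, chain e Gam (c a) p.
  move=> /(GamP conn)[a [b [t [ab t0 t1 ->]]]]; exists a.
  apply: chain_sub (chain_seg _ _ e0); apply: subset_trans (es _ _ ab).
  apply: seg_sub; first exact: seg_l.
  by apply/segP; exists t; rewrite ?t0.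
move=> /vq[a ha] /vq[b hb].
exact: chain_trans (chain_sym ha) (chain_trans (vv a b) hb).
Qed.

(* The plane is simply connected at small scale: the potential is obtained by
   summing the cocycle along a subdivided ray from the origin, with a number of
   steps which is the same for all points of the given ball. *)
Lemma cocycle_potential (chi : pt -> pt -> bool) (e M : R) : 0 < e ->
  (forall p q r, `|p - q| < e -> `|q - r| < e -> `|p - r| < e ->
     chi p q (+) chi q r = chi p r) ->
  exists h : pt -> bool, forall p q, `|p| <= M -> `|q| <= M ->
    `|p - q| < e / 2 -> chi p q = h p (+) h q.
Proof.
move=> e0 co.
have chi0 p : chi p p = false.
  have := co p p p; rewrite subrr normr0 => /(_ e0 e0 e0).
  by case: (chi p p).
have chiC p q : `|p - q| < e -> chi p q = chi q p.
  move=> pq; have := co p q p; rewrite subrr normr0 chi0 (distrC q p).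
  by move=> /(_ pq pq e0); case: (chi p q); case: (chi q p).
(* With this many steps each step of a ray is shorter than [e / 2]. *)
pose N := (Num.truncn (2 * `|M| / e)).+1.
have N0 : 0 < N%:R :> R by rewrite ltr0n.
have MN : `|M| / N%:R < e / 2.
  have : 2 * `|M| / e < N%:R by exact: truncnS_gt.
  by rewrite ltr_pdivrMr // => h; rewrite ltr_pdivrMr //; lra.
pose x k (p : pt) : pt := (k%:R / N%:R) *: p.
pose F k p := \big[addb/false]_(j < k) chi (x j p) (x j.+1 p).
exists (F N) => p q pM qM pq.
have xN z : x N z = z by rewrite /x divff ?gt_eqF // scale1r.
have dx k z : `|z| <= M -> `|x k z - x k.+1 z| < e / 2.
  move=> zM; apply: le_lt_trans MN; rewrite /x -scalerBl prod_norm_scale.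
  rewrite -mulrBl -addn1 natrD opprD addrA subrr add0r mulN1r normrN.
  rewrite gtr0_norm ?invr_gt0 // mulrC ler_pM2r ?invr_gt0 //.
  exact: le_trans zM (ler_norm _).
have dpq k : (k <= N)%N -> `|x k p - x k q| < e / 2.
  move=> kN; rewrite /x -scalerBr prod_norm_scale ger0_norm ?divr_ge0 ?ler0n //.
  apply: le_lt_trans pq; rewrite ler_piMl // ler_pdivrMr // mul1r.
  by rewrite ler_nat.
rewrite -{1}(xN p) -{1}(xN q).
elim: {-2}N (leqnn N) => [_|k IH kN].
  by rewrite /F !big_ord0 /x mul0r !scale0r chi0.
have d1 := dx k p pM; have d2 := dx k q qM; have d3 := dpq k (ltnW kN).
have d4 := dpq _ kN.
(* This diagonal cuts the cell between two consecutive steps of both rays into two triangles with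
   sides below [e], where the cocycle relation applies. *)
have d5 : `|x k.+1 p - x k q| < e.
  have := ler_distD (x k p) (x k.+1 p) (x k q).
  by rewrite (distrC (x k.+1 p) (x k p)); lra.
have FS z : F k.+1 z = F k z (+) chi (x k z) (x k.+1 z).
  by rewrite /F big_ord_recr.
rewrite !FS addbACA -(IH (ltnW kN)) -(co _ (x k q)) //; [|lra|lra].
rewrite -(co (x k.+1 p) (x k p)) //; [|rewrite distrC; lra|lra].
rewrite (chiC (x k.+1 p)); last by rewrite distrC; lra.
by rewrite !addbA [chi (x k p) (x k.+1 p) (+) _]addbC.
Qed.

End Faces.

Section FaceBoundary.
Variables (R : realType) (c : nat -> R * R).
Hypothesis pen : is_penny c.
Hypothesis conn : graph_connected c.
Local Notation pt := (R * R)%type.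
Local Notation Gam := (embedded_graph c).
Local Notation W := (face_vertices c).

(** Slightly lengthened half-edges at the vertices of [S] in [P]. By [face_near], a short step out
    of [S] meets the piece of [P] or that of its complement. *)
Definition boundary_piece (S : set pt) (P : set nat) : set pt :=
  [set q | exists a b t, [/\ edge_pt c q a b t, t <= 11 / 20, W S a & P a]].

Lemma face_change S p p' (P : set nat) : faces c S -> `|p - p'| < 1 / 50 ->
  S p -> ~ S p' ->
  exists q, [/\ boundary_piece S P q \/ boundary_piece S (~` P) q, Gam q,
    segment p p' q, `|p - q| < 1 / 50 & `|p' - q| < 1 / 50].
Proof.
move=> fS pp' Sp nSp'.
have [q [a [b [t [E t1 sq Wa]]]]] := face_near pen conn fS Sp nSp' pp'.
exists q; split=> //.
- by have [Pa|nPa] := pselect (P a); [left|right]; exists a, b, t.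
- by apply/(GamP conn); exists a, b, t.
- exact: le_lt_trans (seg_dist sq) pp'.
- apply: le_lt_trans (seg_dist (segC sq)) _; by rewrite distrC.
Qed.

(** The segment to [c w] from a point of [S] in the disk at [w] leaves [S] inside this disk, which
    meets only edges incident to [w]. *)
Lemma face_vertex_approach S w : faces c S -> W S w ->
  exists z q, [/\ S z, ~ S q, Gam q, `|z - q| < 1 / 100 &
    exists a b t, [/\ edge_pt c q a b t, t <= 11 / 20, W S a &
      a = w \/ adj c a w]].
Proof.
move=> fS [s [Ss /diskE sw]].
have nSw : ~ S (c w) by move=> /(face_sub fS); apply; left; exists w.
have e0 : 0 < 1 / 100 :> R by lra.
have [z [z' [zs z's Sz nSz' zz']]] :=
  chain_change (chain_seg s (c w) e0) Ss nSw.
have zz2 : `|z - z'| < 1 / 50 by lra.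
have [q [a [b [t [E t1 sq Wa]]]]] := face_near pen conn fS Sz nSz' zz2.
have Gq : Gam q by apply/(GamP conn); exists a, b, t.
exists z, q; split=> //.
- by move=> /(face_sub fS).
- exact: le_lt_trans (seg_dist sq) zz'.
exists a, b, t; split=> //.
have qw : sqd q (c w) < 1 / 4.
  apply: (@seg_sqd_lt _ s (c w)).
  - lra.
  - by rewrite sqdC.
  - by rewrite sqdxx; lra.
  - exact: seg_sub sq.
have [->|/eqP aw] := eqVneq a w; first by left.
have [<-|/eqP bw] := eqVneq b w; first by right; case: E.
by exfalso; have := vertex_edge_far pen E (nesym aw) (nesym bw); lra.
Qed.

(* If [W S] split into two parts without edges between them, then the boundary
   of [S] would split into two pieces at positive distance, and crossing the
   first one would be a cocycle: a loop going from one piece to the other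
   inside [S] and back along the graph would have nonzero monodromy. *)
Lemma face_vertices_connected S (P : set nat) u v : faces c S ->
  (forall a b, W S a -> P a -> W S b -> adj c a b -> P b) ->
  W S u -> P u -> W S v -> P v.
Proof.
move=> fS clo Wu Pu Wv; apply: contrapT => nPv.
have [z1 [q1 [Sz1 nSq1 Gq1 zq1 [a1 [b1 [t1 [E1 t11 Wa1 a1u]]]]]]] :=
  face_vertex_approach fS Wu.
have [z2 [q2 [Sz2 nSq2 Gq2 zq2 [a2 [b2 [t2 [E2 t21 Wa2 a2v]]]]]]] :=
  face_vertex_approach fS Wv.
have Pa1 : P a1.
  by case: a1u => [->//|h]; apply: clo Wu Pu Wa1 _; rewrite adjC.
have nPa2 : ~ P a2.
  by case: a2v => [->//|h] Pa2; apply: nPv; apply: clo Wa2 Pa2 Wv h.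
set G1 := boundary_piece S P; set G2 := boundary_piece S (~` P).
(* No point is close to both pieces, by [gap_near]. *)
have G12 p q q' : G1 q -> G2 q' -> `|p - q| < 1 / 25 -> ~ `|p - q'| < 1 / 25.
  move=> [a [b [t [E tt Wa Pa]]]] [a' [b' [t' [E' tt' Wa' nPa']]]] d d'.
  have : 1 / 5 <= sqd q q'.
    apply: (gap_near pen E E') => //.
      by move=> aa'; apply: nPa'; rewrite -aa'.
    by move=> aa'; apply: nPa'; apply: clo Wa Pa Wa' aa'.
  have : `|q - q'| < 2 / 25.
    by have := ler_distD p q q'; rewrite (distrC q p); lra.
  by move/norm_sqd_lt; rewrite expr2; lra.
pose near1 p := exists2 q, G1 q & `|p - q| < 1 / 25.
(* A small triangle with corners inside and outside [S] has a boundary crossing, which lies in one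
   of the two pieces; so [near1] agrees on all three corners. *)
have mixed_near x y z : `|x - y| < 1 / 50 -> `|x - z| < 1 / 50 ->
    `|y - z| < 1 / 50 -> S x -> ~ S y -> (near1 x <-> near1 y) /\
    (near1 z <-> near1 y).
  move=> xy xz yz Sx nSy.
  have [q [G Gq _ xq yq]] := face_change P fS xy Sx nSy.
  have zq : `|z - q| < 1 / 25.
    by have := ler_distD x z q; rewrite (distrC z x); lra.
  have {}xq : `|x - q| < 1 / 25 by lra.
  have {}yq : `|y - q| < 1 / 25 by lra.
  case: G => G; first by split; split=> _; exists q.
  by split; split=> -[q' G' /(G12 _ _ _ G' G)]; tauto.
(* [chi] records the crossings of the boundary of [S] near the first piece. *)
pose chi p q := (`[<S p>] (+) `[<S q>]) && `[<near1 p>].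
have e1 : 0 < 1 / 100 :> R by lra.
have e2 : 0 < 1 / 50 :> R by lra.
have [M1 hM1] := chain_bounded
  (connected_chain e1 (face_connected_set fS) Sz1 Sz2).
have [M2 hM2] := chain_bounded (Gam_chain conn e1 Gq1 Gq2).
pose M := Num.max M1 M2.
have {}hM1 := hM1 M; rewrite le_max lexx in hM1; have {}hM1 := hM1 isT.
have {}hM2 := hM2 M; rewrite le_max lexx orbT in hM2; have {}hM2 := hM2 isT.
have [|h hh] := @cocycle_potential _ chi (1 / 50) M e2.
  move=> p q r pq qr pr; rewrite /chi.
  have [qp rp rq] : [/\ `|q - p| < 1 / 50, `|r - p| < 1 / 50 &
    `|r - q| < 1 / 50] by rewrite ![`|_ - p|]distrC [`|r - q|]distrC.
  have near_eq x y z : `|x - y| < 1 / 50 -> `|x - z| < 1 / 50 ->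
    `|y - z| < 1 / 50 -> S x -> ~ S y ->
    `[<near1 x>] = `[<near1 y>] /\ `[<near1 z>] = `[<near1 y>].
    move=> xy xz yz Sx nSy; have [k1 k2] := mixed_near x y z xy xz yz Sx nSy.
    by split; apply/asbool_equiv_eq.
  case: (asboolP (S p)) => Sp; case: (asboolP (S q)) => Sq;
    case: (asboolP (S r)) => Sr //=.
  - by have [-> ->] := near_eq q r p qr qp rp Sq Sr.
  - by have [-> _] := near_eq p q r pq pr qr Sp Sq; case: `[<_>].
  - by have [-> _] := near_eq p q r pq pr qr Sp Sq; rewrite addbF.
  - by have [_ _] := near_eq q p r qp qr pr Sq Sp; rewrite addbF.
  - by have [<- _] := near_eq q p r qp qr pr Sq Sp; case: `[<_>].
  - by have [k1 k2] := near_eq r q p rq rp qp Sr Sq; rewrite k2.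
have e50 : 1 / 50 / 2 = 1 / 100 :> R by field.
rewrite e50 in hh.
have cst (A : set pt) x y : chain (1 / 100) (A `&` [set z | `|z| <= M]) x y ->
    (forall z z', A z -> A z' -> chi z z' = false) -> h x = h y.
  move=> ch hA; apply: (@chain_inv _ _ _ _ _ (fun z => h x = h z) ch) => //.
  move=> z z' [Az zM] [Az' z'M] zz' ->; have := hh z z' zM z'M zz'.
  by rewrite hA //; case: (h z); case: (h z').
have hz : h z1 = h z2.
  apply: (cst _ _ _ hM1) => z z' Sz Sz'.
  by rewrite /chi (asboolT Sz) (asboolT Sz').
have hq : h q1 = h q2.
  apply: (cst _ _ _ hM2) => z z' Gz Gz'; rewrite /chi.
  have nS y : Gam y -> ~ S y by move=> Gy /(face_sub fS).
  by rewrite (asboolF (nS _ Gz)) (asboolF (nS _ Gz')).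
have [_ z1M] := chain_l hM1; have [_ z2M] := chain_r hM1.
have [_ q1M] := chain_l hM2; have [_ q2M] := chain_r hM2.
(* The potential [h] is constant along the chain in [S] and along the chain in the graph, so it
   changes equally from [z1] to [q1] and from [z2] to [q2]; but only the first crossing is counted
   by [chi]. *)
have := hh _ _ z1M q1M zq1; have := hh _ _ z2M q2M zq2.
rewrite hz hq => <-; rewrite /chi !(asboolT Sz1) !(asboolT Sz2).
rewrite !(asboolF nSq1) !(asboolF nSq2) /= asboolT; last first.
  by exists q1; [exists a1, b1, t1|lra].
have G2q : G2 q2 by exists a2, b2, t2.
rewrite asboolF // => -[q' G1q' zq']; apply: (G12 _ _ _ G1q' G2q zq').
by lra.
Qed.
End FaceBoundary.

(** * Packing bounds and the diameter of faces *)

Section Packing.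
Variables (R : realType) (c : nat -> R * R).
Hypothesis pen : is_penny c.
Hypothesis conn : graph_connected c.
Local Notation pt := (R * R)%type.
Local Notation Gam := (embedded_graph c).
Local Notation W := (face_vertices c).

(** A duplicate-free list in [A] of maximal length exhausts [A]. *)
Lemma bounded_seq (A : set nat) (N : nat) :
  (forall s, uniq s -> (forall v, v \in s -> A v) -> (size s <= N)%N) ->
  exists2 s, uniq s & forall v, v \in s <-> A v.
Proof.
move=> AN.
pose P k := `[<exists s, [/\ uniq s, forall v, v \in s -> A v & size s = k]>].
have P0 : exists k, P k by exists 0; apply/asboolP; exists [::].
have PN k : P k -> (k <= N)%N by move=> /asboolP[s [us sA <-]]; exact: AN.
case: (ex_maxnP P0 PN) => k /asboolP[s [us sA sk]] km.
exists s => // v; split=> [|Av]; first exact: sA.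
apply/negPn/negP => vs; have /km : P k.+1; last by rewrite ltnn.
apply/asboolP; exists (v :: s); rewrite /= vs us sk; split=> // w.
by rewrite inE => /orP[/eqP->//|/sA].
Qed.

(** Cells of side 1/2 contain at most one center each. The index [k] runs from 0 to [4 * n]
    included, whence the added 1. *)
Lemma packing (p : pt) (n : nat) s : uniq s ->
  (forall v, v \in s -> `|c v - p| <= n%:R) -> (size s <= (4 * n + 1) ^ 2)%N.
Proof.
move=> us sn.
pose k (x : R) : 'I_(4 * n).+1 := inord (Num.truncn (2 * (x + n%:R))).
have kP x : `|x| <= n%:R ->
    (k x)%:R <= 2 * (x + n%:R) /\ 2 * (x + n%:R) < (k x)%:R + 1.
  move=> /ler_normlP[x1 x2]; have x0 : 0 <= 2 * (x + n%:R) by lra.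
  have /andP[t1 t2] := truncn_itv x0.
  rewrite /k inordK; first by rewrite natr1.
  rewrite ltnS -(ler_nat R); apply: le_trans t1 _; rewrite natrM; lra.
pose g v := (k ((c v - p).1), k ((c v - p).2)).
have ug : uniq (map g s).
  rewrite map_inj_in_uniq // => v w /sn/normle[v1 v2] /sn/normle[w1 w2].
  move=> [/(congr1 (@nat_of_ord _)) e1 /(congr1 (@nat_of_ord _)) e2].
  apply: contrapT => /(penny_sep pen).
  have [a1 a2] := kP _ v1; have [b1 b2] := kP _ v2.
  have [] := kP _ w1; have [] := kP _ w2; rewrite -e1 -e2 /= => d1 d2 c1 c2.
  have : `|c v - c w| < 1 / 2.
    apply/normlt; rewrite /= in a1 a2 b1 b2 *.
    by split; apply/ltr_normlP; split; lra.
  by move/norm_sqd_lt; rewrite expr2; lra.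
rewrite -(size_map g) -(card_uniqP ug).
apply: leq_trans (max_card _) _.
by rewrite card_prod card_ord addn1 mulnn.
Qed.

Lemma ball_seq (p : pt) (n : nat) :
  exists2 s, uniq s & forall v, v \in s <-> `|c v - p| <= n%:R.
Proof. by apply: bounded_seq => s; exact: packing. Qed.

Lemma far_vertex (p : pt) (n : nat) : exists v, n%:R < `|c v - p|.
Proof.
apply: contrapT => h; pose N := ((4 * n + 1) ^ 2).+1.
suff : (size (iota 0 N) <= (4 * n + 1) ^ 2)%N by rewrite size_iota ltnn.
apply: (@packing p) => [|v _]; first exact: iota_uniq.
by rewrite leNgt; apply/negP => nv; apply: h; exists v.
Qed.

(** Choosing one corner at each vertex of [S] is injective, since a corner records its vertex. *)
Lemma face_size S (D : nat) s : (facial_degree c S <= D%:R%:E)%E -> uniq s ->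
  (forall v, v \in s -> W S v) -> (size s <= D)%N.
Proof.
rewrite /facial_degree /counting.
case: (asboolP (finite_set (corners c S))) => [fin|_]; last by rewrite leye_eq.
rewrite lee_fin ler_nat => cD us sW.
have gP v : exists U, W S v -> corners c S (v, U).
  have [[p Sp]|nW] := pselect (W S v); last by exists setT => /nW.
  by exists (connected_component (S `&` disk (c v)) p) => _; exists p.
have [g hg] := choice gP.
apply: leq_trans cD; rewrite -(size_map (fun v => (v, g v))).
apply: uniq_leq_size; first by rewrite map_inj_uniq // => x y [].
move=> x /mapP[v /sW Wv ->].
by rewrite in_fset_set // inE; apply: hg.
Qed.

Lemma path_norm u s : path (adj c) u s -> `|c u - c (last u s)| <= (size s)%:R.
Proof.
elim: s u => [|v s IH] u /=; first by rewrite subrr normr0.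
move=> /andP[/adj_norm uv /IH]; rewrite -natr1 => h.
by have := ler_distD (c v) (c u) (c (last v s)); lra.
Qed.

(** Paths are simple, so that their length is bounded by the size of [Z], and sums along them by
    sums over [Z]. *)
Definition joined (Z : set nat) (u v : nat) : Prop :=
  exists s, [/\ path (adj c) u s, last u s = v, uniq (u :: s) &
    forall w, w \in u :: s -> Z w].

Lemma joined_refl Z u : Z u -> joined Z u u.
Proof. by move=> Zu; exists [::]; split=> // w; rewrite inE => /eqP ->. Qed.

Lemma joined_path (Z : set nat) u s : path (adj c) u s ->
  (forall w, w \in u :: s -> Z w) -> joined Z u (last u s).
Proof.
move=> us sZ; case: (shortenP us) => s' us' un sub.
exists s'; split=> // w; rewrite inE => /orP[/eqP ->|/sub h].
  by apply: sZ; rewrite mem_head.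
by apply: sZ; rewrite inE h orbT.
Qed.

Lemma joined_trans Z u v w : joined Z u v -> joined Z v w -> joined Z u w.
Proof.
move=> [s [us <- _ sZ]] [s' [us' <- _ sZ']].
rewrite -last_cat; apply: joined_path; first by rewrite cat_path us.
move=> x; rewrite -cat_cons mem_cat => /orP[/sZ//|h].
by apply: sZ'; rewrite inE h orbT.
Qed.

Lemma joined_adj (Z : set nat) u v : Z u -> Z v -> adj c u v -> joined Z u v.
Proof.
move=> Zu Zv uv; rewrite -[v]/(last u [:: v]); apply: joined_path => /=.
  by rewrite uv.
by move=> w; rewrite !inE => /orP[/eqP ->|/eqP ->].
Qed.

(** A simple path through vertices of [S] only has at most [D] vertices, and each edge has length
    1. *)
Lemma face_diam S (D : nat) u v : faces c S ->
  (facial_degree c S <= D%:R%:E)%E -> W S u -> W S v ->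
  `|c u - c v| <= D%:R.
Proof.
move=> fS dS Wu Wv.
have [s [us sv un sW]] : joined (W S) u v.
  apply: (face_vertices_connected pen conn fS _ Wu (joined_refl Wu) Wv).
  by move=> a b Wa ua Wb ab; apply: joined_trans ua _; apply: joined_adj.
have := face_size dS un sW; move/path_norm: us; rewrite sv /= => h1 h2.
by apply: le_trans h1 _; rewrite ler_nat ltnW.
Qed.

End Packing.

(** * Comparison of the graph with the plane *)

Section QuasiIsometry.
Variables (R : realType) (c : nat -> R * R) (D : nat).
Hypothesis pen : is_penny c.
Hypothesis conn : graph_connected c.
Hypothesis deg : forall S, faces c S -> (facial_degree c S <= D%:R%:E)%E.
Local Notation pt := (R * R)%type.
Local Notation Gam := (embedded_graph c).
Local Notation W := (face_vertices c).

(** A segment can leave [S] only within distance 1 of a vertex of [S], hence within sup distance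
    [D + 1] of [c w]. *)
Lemma face_escape_seg S w z z' : faces c S -> W S w -> S z ->
  (forall y, segment z z' y -> 2 * (D%:R + 1) ^+ 2 < sqd (c w) y) -> S z'.
Proof.
move=> fS Ww Sz far; apply: contrapT => nSz'.
have e0 : 0 < 1 / 50 :> R by lra.
have [z1 [z2 [zz1 zz2 Sz1 nSz2 z12]]] :=
  chain_change (chain_seg z z' e0) Sz nSz'.
have [q [a [b [t [E t1 sq Wa]]]]] := face_near pen conn fS Sz1 nSz2 z12.
have := far q (seg_sub zz1 zz2 sq); apply/negP; rewrite -leNgt ltW // sqdC.
apply: norm_sqd_lt; have := edge_pt_norm E.
have := face_diam pen conn fS (deg fS) Wa Ww.
by have := ler_distD (c a) q (c w); lra.
Qed.

(* [y] is the intersection of the tangents at [z] and [z'] to the circles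
   centered at [o] through these points. *)
Lemma tangents_meet (o z z' : pt) :
  (z.1 - o.1) * (z'.2 - o.2) - (z.2 - o.2) * (z'.1 - o.1) != 0 ->
  exists y, (forall x, segment z y x -> sqd o z <= sqd o x) /\
    (forall x, segment y z' x -> sqd o z' <= sqd o x).
Proof.
case: o z z' => o1 o2 [z1 z2] [z1' z2'] /=.
set d := (_ - _ : R) => d0.
pose A := (z1 - o1) ^+ 2 + (z2 - o2) ^+ 2.
pose B := (z1' - o1) ^+ 2 + (z2' - o2) ^+ 2.
pose y1 := o1 + (A * (z2' - o2) - B * (z2 - o2)) / d.
pose y2 := o2 + (B * (z1 - o1) - A * (z1' - o1)) / d.
have o1z : (y1 - z1) * (z1 - o1) + (y2 - z2) * (z2 - o2) = 0.
  by rewrite /y1 /y2 /A /B /d in d0 *; field.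
have o2z : (y1 - z1') * (z1' - o1) + (y2 - z2') * (z2' - o2) = 0.
  by rewrite /y1 /y2 /A /B /d in d0 *; field.
exists (y1, y2); split=> x /segP[t _ ->].
  rewrite -subr_ge0; have -> : sqd (o1, o2) (lerp (z1, z2) (y1, y2) t) -
      sqd (o1, o2) (z1, z2) = t ^+ 2 * sqd (y1, y2) (z1, z2) +
        2 * t * ((y1 - z1) * (z1 - o1) + (y2 - z2) * (z2 - o2)).
    by rewrite /sqd !(lerpE1, lerpE2) /=; ring.
  by rewrite o1z mulr0 addr0 mulr_ge0 ?sqr_ge0 ?sqd_ge0.
rewrite -subr_ge0; have -> : sqd (o1, o2) (lerp (y1, y2) (z1', z2') t) -
    sqd (o1, o2) (z1', z2') = (1 - t) ^+ 2 * sqd (y1, y2) (z1', z2') +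
      2 * (1 - t) * ((y1 - z1') * (z1' - o1) + (y2 - z2') * (z2' - o2)).
  by rewrite /sqd !(lerpE1, lerpE2) /=; ring.
by rewrite o2z mulr0 addr0 mulr_ge0 ?sqr_ge0 ?sqd_ge0.
Qed.

(** Two points outside the disk around [c w] are joined outside it by two segments along
    tangents. *)
Lemma face_escape S w z z' : faces c S -> W S w -> S z ->
  2 * (D%:R + 1) ^+ 2 < sqd (c w) z -> 2 * (D%:R + 1) ^+ 2 < sqd (c w) z' ->
  S z'.
Proof.
move=> fS Ww.
have gen z1 z2 : (z1.1 - (c w).1) * (z2.2 - (c w).2) -
    (z1.2 - (c w).2) * (z2.1 - (c w).1) != 0 -> S z1 ->
    2 * (D%:R + 1) ^+ 2 < sqd (c w) z1 -> 2 * (D%:R + 1) ^+ 2 < sqd (c w) z2 ->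
    S z2.
  move=> /tangents_meet[y [h1 h2]] Sz1 f1 f2.
  have Sy : S y.
    by apply: (face_escape_seg fS Ww Sz1) => x /h1; apply: lt_le_trans.
  by apply: (face_escape_seg fS Ww Sy) => x /h2; apply: lt_le_trans.
move=> Sz f1 f2.
set d := ((z.1 - (c w).1) * (z'.2 - (c w).2) -
    (z.2 - (c w).2) * (z'.1 - (c w).1)).
have [d0|d0] := eqVneq d 0; last exact: (gen z).
(* If [z], [z'] and [c w] are collinear, the way goes through the quarter turn [m] of [z] about
   [c w]. *)
pose m : pt := ((c w).1 - (z.2 - (c w).2), (c w).2 + (z.1 - (c w).1)).
have mz : sqd (c w) m = sqd (c w) z by rewrite /sqd /m /=; ring.
have K0 : 0 <= 2 * (D%:R + 1) ^+ 2 :> R by rewrite mulr_ge0 ?sqr_ge0.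
have Sm : S m.
  apply: (gen z) => //; last by rewrite mz.
  rewrite [X in X != 0](_ : _ = sqd (c w) z); last by rewrite /sqd /m /=; ring.
  by rewrite gt_eqF //; lra.
apply: (gen m) => //; last by rewrite mz.
apply/eqP => e; have : sqd (c w) z * sqd (c w) z' = 0; last first.
  by apply/eqP; rewrite mulf_neq0 ?gt_eqF //; lra.
(* Lagrange's identity: the second square is that of the scalar product of [z - c w] and
   [z' - c w]. *)
transitivity (d ^+ 2 + ((m.1 - (c w).1) * (z'.2 - (c w).2) -
    (m.2 - (c w).2) * (z'.1 - (c w).1)) ^+ 2).
  by rewrite /d /sqd /m /=; ring.
by rewrite e d0 !expr0n addr0.
Qed.

(** An integer above [sqrt 2 (D + 1)], the radius of the disk in [face_escape]. *)
Definition reach : R := 2 * (D%:R + 1).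

Lemma reach_ge2 : 2 <= reach.
Proof. by rewrite /reach; have : 0 <= D%:R :> R by []; lra. Qed.

(** A face with a point far from [c w] would contain every point far from [c w], among them a
    vertex, since there are infinitely many. *)
Lemma face_reach S w z : faces c S -> W S w -> S z -> `|c w - z| <= reach.
Proof.
move=> fS Ww Sz; have D0 : 0 <= D%:R :> R by [].
have K : 2 * (D%:R + 1) ^+ 2 <= reach ^+ 2 :> R.
  by rewrite /reach exprMn expr2 ler_wpM2r ?sqr_ge0 //; lra.
apply: sqd_norm_le; first by have := reach_ge2; lra.
apply: (le_trans _ K); rewrite leNgt; apply/negP => zf.
have [v vf] := far_vertex pen (c w) (2 * (D + 1)).
have rE : (2 * (D + 1))%:R = reach by rewrite natrM natrD.
suff : S (c v) by move/(face_sub fS); apply; left; exists v.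
apply: face_escape fS Ww Sz zf _; apply: (le_lt_trans K).
rewrite ltNge; apply/negP; rewrite sqdC => /sqd_norm_le h.
have : `|c v - c w| <= reach by apply: h; have := reach_ge2; lra.
by rewrite -rE leNgt vf.
Qed.

Lemma face_vertices_nonempty S : faces c S -> exists w, W S w.
Proof.
move=> fS; have [z Sz] : exists z, S z.
  by case: fS => p Gp <-; exists p; apply: connected_component_refl.
have nS0 : ~ S (c 0) by move/(face_sub fS); apply; left; exists 0.
have e0 : 0 < 1 / 50 :> R by lra.
have [z1 [z2 [_ _ Sz1 nSz2 z12]]] := chain_change (chain_seg z _ e0) Sz nS0.
have [q [a [b [t [_ _ _ Wa]]]]] := face_near pen conn fS Sz1 nSz2 z12.
by exists a.
Qed.

(** By [edge_pt_sym], the first clause covers both ends of every edge through [z]. *)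
Definition incident (z : pt) (w : nat) : Prop :=
  (exists b t, edge_pt c z w b t) \/
  (~ Gam z /\ W (connected_component (~` Gam) z) w).

Lemma incident_ex z : exists w, incident z w.
Proof.
have [/(GamP conn)[a [b [t E]]]|nG] := pselect (Gam z).
  by exists a; left; exists b, t.
have [|w Ww] := @face_vertices_nonempty (connected_component (~` Gam) z).
  by exists z.
by exists w; right.
Qed.

Lemma incident_reach z w : incident z w -> `|c w - z| <= reach.
Proof.
have r2 := reach_ge2.
case=> [[b [t E]]|[nG Ww]].
  have := edge_pt_norm E; case: E => _ _ t1 _; rewrite distrC; lra.
apply: face_reach Ww _; first by exists z.
exact: connected_component_refl.
Qed.

Lemma vertex_near z : exists w, `|c w - z| <= reach.
Proof. by have [w /incident_reach] := incident_ex z; exists w. Qed.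

(* The points of the segment are classified by whether their incident vertices
   lie in the component of [u] in [Z]; by the gap between disjoint edges and the
   connectedness of the boundary of a face this is locally constant. *)
Lemma joined_along_segment (Z : set nat) u v :
  (forall z w, segment (c u) (c v) z -> `|c w - z| <= reach -> Z w) ->
  joined c Z u v.
Proof.
move=> HZ; pose Z1 : set nat := joined c Z u.
have r2 := reach_ge2.
have clo a b : Z1 a -> Z b -> adj c a b -> Z1 b.
  move=> ua Zb ab; apply: (joined_trans ua); apply: joined_adj ab => //.
  by case: ua => s [_ <- _ sZ]; apply: sZ; exact: mem_last.
have Z1u : Z1 u.
  apply: joined_refl; apply: (HZ (c u)); first exact: seg_l.
  by rewrite subrr normr0; lra.
have HZi z w : segment (c u) (c v) z -> incident z w -> Z w.
  by move=> sz /incident_reach; apply: HZ.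
pose T z := exists2 w, incident z w & Z1 w.
(* Close points lie on edges that share a vertex, by [gap_far]; along an edge, membership in [Z1]
   passes from one end to the other. *)
have TG z z' w' : segment (c u) (c v) z -> segment (c u) (c v) z' -> Gam z ->
    Gam z' -> `|z - z'| < 1 / 50 -> T z -> incident z' w' -> Z1 w'.
  move=> sz sz' Gz Gz' zz' [w [[b [t E]]|[]//] Zw] [[b' [t' E']]|[]//].
  apply: contrapT => nw'.
  have ib : incident z b by left; exists w, (1 - t); apply: edge_pt_sym.
  have iw' : incident z' w' by left; exists b', t'.
  have ib' : incident z' b' by left; exists w', (1 - t'); apply: edge_pt_sym.
  have Zb : Z1 b by apply: clo Zw (HZi _ _ sz ib) _; case: E.
  have nb' : ~ Z1 b'.
    move=> Zb'; apply: nw'; apply: clo Zb' (HZi _ _ sz' iw') _.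
    by rewrite adjC; case: E'.
  have neq x y : Z1 x -> ~ Z1 y -> x <> y by move=> Zx nZy e; rewrite e in Zx.
  have := gap_far pen E E' (neq _ _ Zw nw') (neq _ _ Zw nb') (neq _ _ Zb nw')
    (neq _ _ Zb nb').
  by have := norm_sqd_lt zz'; rewrite expr2; lra.
have TS z w : segment (c u) (c v) z -> ~ Gam z -> T z ->
    W (connected_component (~` Gam) z) w -> Z1 w.
  move=> sz nGz [w0 [[b [t E]]|[_ Ww0]] Zw0] Ww.
    by case: nGz; apply/(GamP conn); exists w0, b, t.
  apply: (face_vertices_connected pen conn _ _ Ww0 Zw0 Ww); first by exists z.
  by move=> a b Wa Za Wb; apply: clo Za _; apply: HZi sz _; right.
have bd z z' : segment (c u) (c v) z -> segment (c u) (c v) z' -> ~ Gam z ->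
    ~ connected_component (~` Gam) z z' -> `|z - z'| < 1 / 50 ->
    exists q a, [/\ segment (c u) (c v) q, Gam q, `|q - z'| < 1 / 50,
      incident q a & W (connected_component (~` Gam) z) a].
  move=> sz sz' nG nz' zz'.
  have fS : faces c (connected_component (~` Gam) z) by exists z.
  have Sz : connected_component (~` Gam) z z by exact: connected_component_refl.
  have [q [a [b [t [E _ sq Wa]]]]] := face_near pen conn fS Sz nz' zz'.
  exists q, a; split=> //; first exact: seg_sub sq.
  - by apply/(GamP conn); exists a, b, t.
  - by have := seg_dist (segC sq); rewrite distrC (distrC z'); lra.
  - by left; exists b, t.
have TT z z' : segment (c u) (c v) z -> segment (c u) (c v) z' ->
    `|z - z'| < 1 / 50 -> T z -> T z'.
  move=> sz sz' zz' Tz.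
  have [Szz'|nSzz'] :=
    pselect (~ Gam z /\ connected_component (~` Gam) z z').
    have [nGz cz'] := Szz'; have [|w Ww] := @face_vertices_nonempty
      (connected_component (~` Gam) z); first by exists z.
    exists w; last exact: TS Ww.
    right; split; first by move: cz' => /connected_component_sub.
    by rewrite -(same_connected_component cz').
  (* Otherwise a graph point [q] of the segment takes over. If [z'] lies in a face, that face is in
     turn left on the way from [z'] to [q], at a graph point close to [q]. *)
  have [q [sq Gq qz' Tq]] : exists q, [/\ segment (c u) (c v) q, Gam q,
      `|q - z'| < 1 / 50 & T q].
    have [Gz|nGz] := pselect (Gam z); first by exists z.
    have ncz' : ~ connected_component (~` Gam) z z'.
      by move=> h; apply: nSzz'.
    have [q [a [sq Gq qz' qa Wa]]] := bd _ _ sz sz' nGz ncz' zz'.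
    by exists q; split=> //; exists a => //; apply: TS Wa.
  have [Gz'|nGz'] := pselect (Gam z').
    have [w iw] := incident_ex z'; exists w => //.
    exact: (TG q z').
  have ncq : ~ connected_component (~` Gam) z' q.
    by move=> /connected_component_sub.
  have [|q' [a [sq' Gq' qq' qa Wa]]] := bd _ _ sz' sq nGz' ncq.
    by rewrite distrC.
  exists a; first by right.
  apply: TG qa => //; first exact: sq; by rewrite // distrC.
have e0 : 0 < 1 / 50 :> R by lra.
have Tv : T (c v).
  apply: (chain_inv (chain_seg (c u) (c v) e0) TT).
  by have [b ub] := adj_ex conn u; exists u => //; left; exists b, 0;
    exact: edge_pt_vertex.
apply: TG Tv _; [exact: seg_r|exact: seg_r|exact: Gam_vertex|exact: Gam_vertex|
  by rewrite subrr normr0|].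
by have [b ub] := adj_ex conn v; left; exists b, 0; exact: edge_pt_vertex.
Qed.

(** The packing bound for the sup radius [6 * D + 7], which is [3 * reach + 1]. *)
Definition stretch : nat := ((4 * (6 * D + 7) + 1) ^ 2)%N.

(** The segment is cut into steps of length at most 1. Vertices near consecutive points are joined
    by simple paths in a square of fixed radius, hence of length at most [stretch]. *)
Lemma walk_linear_bound n u v : `|c u - c v| <= n%:R ->
  exists s, [/\ path (adj c) u s, last u s = v & (size s <= stretch * n.+1)%N].
Proof.
pose a := (6 * D + 7)%N; pose M := stretch.
have aE : a%:R = 2 * reach + 1 + reach.
  by rewrite /a /reach natrD natrM; ring.
have r2 := reach_ge2.
have loc u' v' : `|c u' - c v'| <= 2 * reach + 1 ->
    exists s, [/\ path (adj c) u' s, last u' s = v' & (size s <= M)%N].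
  move: u' v' => {}u {}v uv; pose Z := [set w | `|c w - c u| <= a%:R].
  have [|s [us sv un sZ]] := @joined_along_segment Z u v.
    move=> z w sz wz; rewrite /Z /= aE.
    have := seg_dist sz; have := ler_distD z (c w) (c u).
    by rewrite (distrC z); lra.
  exists s; split=> //; have := packing pen un sZ; exact: ltnW.
(* The induction follows a point [z] of the segment instead of a vertex, so that the errors [reach]
   do not accumulate. *)
suff H (z : pt) : `|c u - z| <= reach -> `|z - c v| <= n%:R ->
    exists s, [/\ path (adj c) u s, last u s = v & (size s <= M * n.+1)%N].
  by move=> uv; apply: (H (c u)); rewrite // subrr normr0; lra.
elim: n z u => [|n IH] z u uz zv.
  have [|s [us sv sM]] := loc u v; last by exists s; rewrite muln1.
  by have := ler_distD z (c u) (c v); lra.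
pose z' := lerp z (c v) (n.+1%:R)^-1.
have n0 : 0 < n.+1%:R :> R by rewrite ltr0n.
have n1 : n.+1%:R != 0 :> R by rewrite gt_eqF.
have zz' : `|z - z'| <= 1.
  have -> : z - z' = (n.+1%:R)^-1 *: (z - c v).
    by apply: pt_eq => /=; rewrite /z' /= ?lerpE1 ?lerpE2 /GRing.scale /=; ring.
  by rewrite prod_norm_scale gtr0_norm ?invr_gt0 // mulrC ler_pdivrMr // mul1r.
have z'v : `|z' - c v| <= n%:R.
  have -> : z' - c v = (n%:R / n.+1%:R) *: (z - c v).
    by apply: pt_eq => /=; rewrite /z' /= ?lerpE1 ?lerpE2 /GRing.scale /=;
      rewrite -natr1 in n1 *; field.
  rewrite prod_norm_scale ger0_norm ?divr_ge0 ?ler0n //.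
  apply: le_trans (ler_wpM2l _ zv) _; first by rewrite divr_ge0 ?ler0n.
  by rewrite divfK.
have [w wz'] := vertex_near z'.
have [s [ws sv sM]] := IH _ _ wz' z'v.
have [|s' [us' s'w sM']] := loc u w.
  have := ler_distD z (c u) (c w); have := ler_distD z' z (c w).
  by rewrite (distrC z' (c w)); lra.
exists (s' ++ s); split; first by rewrite cat_path us' s'w.
  by rewrite last_cat s'w.
by rewrite size_cat (mulnS M n.+1) leq_add.
Qed.

End QuasiIsometry.

(** * Annuli and the maximum principle *)

Section Annulus.
Variables (R : realType) (c : nat -> R * R) (D : nat).
Hypothesis pen : is_penny c.
Hypothesis conn : graph_connected c.
Hypothesis deg : forall S, faces c S -> (facial_degree c S <= D%:R%:E)%E.
Local Notation pt := (R * R)%type.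
Local Notation L := (reach R D).

(** In the sup norm this is a square frame. *)
Definition annulus (x : nat) (s K : R) : set nat :=
  [set w | s - K <= `|c w - c x| <= s + K].

Lemma joined_sym Z u v : joined c Z u v -> joined c Z v u.
Proof.
move=> [s [us sv _ sZ]].
suff H u' t : path (adj c) u' t -> (forall w, w \in u' :: t -> Z w) ->
    joined c Z (last u' t) u' by rewrite -sv; apply: H.
elim: t u' => [|a t IH] u' /=.
  by move=> _ tZ; apply: joined_refl; apply: tZ; rewrite mem_head.
move=> /andP[ua ta] tZ.
have Zu : Z u' by apply: tZ; rewrite mem_head.
have Za : Z a by apply: tZ; rewrite !inE eqxx orbT.
apply: (joined_trans (IH a ta _)).
  by move=> w wt; apply: tZ; rewrite inE wt orbT.
by apply: joined_adj; rewrite // adjC.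
Qed.

(** The half-plane [s - L <= l] is convex and avoids the inner square. The path given by
    [joined_along_segment] deviates from the segment by at most [L]. *)
Lemma side_joined (l : pt -> R) (x : nat) (s : R) (u v : nat) :
  (forall p q t, l (lerp p q t) = (1 - t) * l p + t * l q) ->
  (forall p, l p <= `|p - c x|) ->
  s - L <= l (c u) -> s - L <= l (c v) ->
  `|c u - c x| <= s + 1 + L -> `|c v - c x| <= s + 1 + L ->
  joined c (annulus x s (2 * L + 1)) u v.
Proof.
move=> ll ln lu lv nu nv.
apply: (joined_along_segment pen conn deg) => z w sz wz.
apply/andP; split; last first.
  have := seg_convex_le nu nv sz; have := ler_distD z (c w) (c x); lra.
have lz : s - L <= l z.
  move: sz => /segP[t /andP[t0 t1] ->]; rewrite ll.
  have : 0 <= t * (l (c v) - (s - L)) by rewrite mulr_ge0 //; lra.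
  have : 0 <= (1 - t) * (l (c u) - (s - L)) by rewrite mulr_ge0 //; lra.
  lra.
have := ln z; have := ler_distD (c w) z (c x); rewrite (distrC z (c w)).
have := reach_ge2 R D; lra.
Qed.

(* Each side of the annulus is a convex region; two sides are linked by a vertex
   near their common corner. *)
Lemma annulus_joined (x : nat) (s : R) (u v : nat) : 0 <= s ->
  s <= `|c u - c x| -> `|c u - c x| <= s + 1 ->
  s <= `|c v - c x| -> `|c v - c x| <= s + 1 ->
  joined c (annulus x s (2 * L + 1)) u v.
Proof.
move=> s0 u1 u2 v1 v2; have r2 := reach_ge2 R D.
have corner (a b : R) : `|a| = s -> `|b| = s -> exists w,
    [/\ `|c w - c x| <= s + 1 + L, a - L <= (c w).1 - (c x).1,
     (c w).1 - (c x).1 <= a + L, b - L <= (c w).2 - (c x).2 &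
     (c w).2 - (c x).2 <= b + L].
  move=> sa sb; pose z : pt := ((c x).1 + a, (c x).2 + b).
  have [w wz] := vertex_near pen conn deg z; exists w.
  have zx : `|z - c x| <= s.
    have kd (y a' : R) : y + a' - y = a' by ring.
    by apply/normle; rewrite /= !kd sa sb.
  have := ler_distD z (c w) (c x) => h.
  have /normle[] := wz; rewrite /z /= => /ler_normlP[? ?] /ler_normlP[? ?].
  by split; rewrite -/z; lra.
pose l1 (p : pt) := p.1 - (c x).1; pose l2 (p : pt) := (c x).1 - p.1.
pose l3 (p : pt) := p.2 - (c x).2; pose l4 (p : pt) := (c x).2 - p.2.
have lin1 p q t : l1 (lerp p q t) = (1 - t) * l1 p + t * l1 q.
  by rewrite /l1 lerpE1; ring.
have lin2 p q t : l2 (lerp p q t) = (1 - t) * l2 p + t * l2 q.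
  by rewrite /l2 lerpE1; ring.
have lin3 p q t : l3 (lerp p q t) = (1 - t) * l3 p + t * l3 q.
  by rewrite /l3 lerpE2; ring.
have lin4 p q t : l4 (lerp p q t) = (1 - t) * l4 p + t * l4 q.
  by rewrite /l4 lerpE2; ring.
have nor p : [/\ l1 p <= `|p - c x|, l2 p <= `|p - c x|, l3 p <= `|p - c x| &
    l4 p <= `|p - c x|].
  have /normle[/= /ler_normlP[h1 h2] /ler_normlP[h3 h4]] := lexx `|p - c x|.
  by rewrite /l1 /l2 /l3 /l4; split; lra.
have nor1 p : l1 p <= `|p - c x| by case: (nor p).
have nor2 p : l2 p <= `|p - c x| by case: (nor p).
have nor3 p : l3 p <= `|p - c x| by case: (nor p).
have nor4 p : l4 p <= `|p - c x| by case: (nor p).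
have side a : s <= `|c a - c x| ->
    [\/ s <= l1 (c a), s <= l2 (c a), s <= l3 (c a) | s <= l4 (c a)].
  rewrite prod_normE le_max => /orP[]; rewrite ler_normr => /orP[] /= h.
  - by apply: Or41; rewrite /l1; lra.
  - by apply: Or42; rewrite /l2; lra.
  - by apply: Or43; rewrite /l3; lra.
  - by apply: Or44; rewrite /l4; lra.
have sN : `|- s| = s by rewrite normrN ger0_norm.
have sP := ger0_norm s0.
(* Three corners link the four sides: [w1] is common to right and top, [w2] to top and left, [w3] to
   right and bottom. *)
have [w1 [n1 a1 b1 d1 e1]] := corner s s sP sP.
have [w2 [n2 a2 b2 d2 e2]] := corner (- s) s sN sP.
have [w3 [n3 a3 b3 d3 e3]] := corner s (- s) sP sN.
have J21 : joined c (annulus x s (2 * L + 1)) w2 w1.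
  by apply: (side_joined lin3 nor3); rewrite ?/l3 //; lra.
have J31 : joined c (annulus x s (2 * L + 1)) w3 w1.
  by apply: (side_joined lin1 nor1); rewrite ?/l1 //; lra.
have J a : s <= `|c a - c x| -> `|c a - c x| <= s + 1 ->
    joined c (annulus x s (2 * L + 1)) a w1.
  move=> /side + a2'; case=> h.
  - by rewrite /l1 in h; apply: (side_joined lin1 nor1); rewrite ?/l1 //; lra.
  - apply: joined_trans J21.
    by rewrite /l2 in h; apply: (side_joined lin2 nor2); rewrite ?/l2 //; lra.
  - by rewrite /l3 in h; apply: (side_joined lin3 nor3); rewrite ?/l3 //; lra.
  - apply: joined_trans J31.
    by rewrite /l4 in h; apply: (side_joined lin4 nor4); rewrite ?/l4 //; lra.
exact: joined_trans (J _ u1 u2) (joined_sym (J _ v1 v2)).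
Qed.

End Annulus.

Section MaximumPrinciple.
Variables (R : realType) (c : nat -> R * R).
Hypothesis pen : is_penny c.
Hypothesis conn : graph_connected c.

Lemma laplacian_seq (f : nat -> R) (y : nat) (B : seq nat) : uniq B ->
  (forall z, adj c y z -> z \in B) ->
  laplacian c f y = \sum_(z <- B | adj c y z) (f z - f y).
Proof.
move=> uB yB; rewrite /laplacian -[RHS]big_filter.
rewrite (_ : [set z | adj c y z] = [set` [seq z <- B | adj c y z]]).
  by rewrite -fsbig_seq // filter_uniq.
apply/seteqP; split=> z /=; rewrite mem_filter.
  by move=> yz; rewrite yz yB.
by case/andP.
Qed.

(** The value 25 is the packing bound for radius 1. *)
Lemma nbr_seq (y : nat) : exists B, [/\ uniq B, (size B <= 25)%N &
  forall z, z \in B <-> adj c y z].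
Proof.
have [s us sP] := ball_seq pen (c y) 1.
exists [seq z <- s | adj c y z]; split; first exact: filter_uniq.
  rewrite size_filter; apply: leq_trans (count_size _ _) _.
  by apply: (@packing _ _ pen (c y) 1 s) => // v /sP.
move=> z; rewrite mem_filter; split=> [/andP[]//|yz]; rewrite yz /=.
by apply/sP; apply: adj_norm; rewrite adjC.
Qed.

Lemma seq_argmax (f : nat -> R) (s : seq nat) u : u \in s ->
  exists2 y, y \in s & forall z, z \in s -> f z <= f y.
Proof.
elim: s u => [//|a s IH] u _.
case: s IH => [_|b s /(_ b (mem_head _ _))[y ys ym]].
  by exists a; rewrite ?mem_head // => z; rewrite inE => /eqP ->.
have [fay|fya] := leP (f a) (f y).
  exists y; first by rewrite inE ys orbT.
  by move=> z; rewrite inE => /orP[/eqP ->//|/ym].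
exists a; first by rewrite mem_head.
move=> z; rewrite inE => /orP[/eqP ->//|/ym h]; exact: le_trans h (ltW fya).
Qed.

Lemma walk_closed (Y : set nat) u v :
  (forall a b, Y a -> adj c a b -> Y b) -> Y u -> Y v.
Proof.
move=> clo Yu; have [n [s [us <- _]]] := conn u v.
elim: s u Yu us => [//|a s IH] u Yu /= /andP[ua]; apply: IH; exact: clo ua.
Qed.

(** Otherwise the maximum over the open square exceeds all values on the surrounding frame of width
    1. Its maximizers are then closed under adjacency and fill the whole graph, which is
    unbounded. *)
Lemma maximum_principle (f : nat -> R) (x u : nat) (s : R) :
  (forall y, `|c y - c x| < s -> laplacian c f y = 0) ->
  `|c u - c x| < s ->
  exists y, [/\ s <= `|c y - c x|, `|c y - c x| <= s + 1 & f u <= f y].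
Proof.
move=> harm us; apply: contrapT => no.
pose n := (Num.truncn s).+1.
have sn : s < n%:R by exact: truncnS_gt.
have [B uB BP] := ball_seq pen (c x) n.
pose T := [seq y <- B | `|c y - c x| < s].
have TP y : y \in T <-> `|c y - c x| < s.
  rewrite mem_filter; split=> [/andP[]//|ys]; rewrite ys /=; apply/BP.
  by rewrite ltW // (lt_trans ys).
have [y0 y0T y0m] := seq_argmax f ((TP u).2 us).
have fu : f u <= f y0 by apply: y0m; apply/TP.
pose Y : set nat := [set y | `|c y - c x| < s /\ f y = f y0].
have clo a b : Y a -> adj c a b -> Y b.
  move=> [ax fa] ab; have [N [uN _ NP]] := nbr_seq a.
  have le_nbr z : adj c a z -> f z <= f y0 /\ (f z = f y0 -> `|c z - c x| < s).
    move=> az; have [zs|zs] := ltP `|c z - c x| s.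
      by split=> //; apply: y0m; apply/TP.
    have zs1 : `|c z - c x| <= s + 1.
      have := ler_distD (c a) (c z) (c x).
      by have := adj_norm az; rewrite (distrC (c a) (c z)); lra.
    have fz : f z < f u.
      by rewrite ltNge; apply/negP => h; apply: no; exists z.
    split; first exact: ltW (lt_le_trans fz fu).
    by move=> e; move: fz; rewrite e ltNge fu.
  (* The differences [f z - f y0] are nonpositive with sum zero, so each of them vanishes. *)
  have := harm a ax; rewrite (laplacian_seq f uN) => [|z az]; last exact/NP.
  rewrite fa => /eqP; rewrite -oppr_eq0 -sumrN psumr_eq0 => [/allP|z az].
    move=> /(_ b) h; have fb : f b = f y0.
      have /h : b \in N by apply/NP.
      by rewrite ab /= oppr_eq0 subr_eq0 => /eqP.
    by split=> //; have [_] := le_nbr b ab; apply.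
  by rewrite oppr_ge0 subr_le0; case: (le_nbr z az).
have Yy0 : Y y0 by split=> //; apply/TP.
have [v vn] := far_vertex pen (c x) n.
have [vs _] : Y v := walk_closed v clo Yy0.
lra.
Qed.

End MaximumPrinciple.

(** * Energy of the logarithm *)

Section LogEnergy.
Variables (R : realType) (c : nat -> R * R).
Hypothesis pen : is_penny c.

Lemma ler_sum_seq_sub (s : seq nat) (P Q : pred nat) (F G : nat -> R) :
  (forall z, z \in s -> P z -> Q z /\ F z <= G z) ->
  (forall z, z \in s -> Q z -> 0 <= G z) ->
  \sum_(z <- s | P z) F z <= \sum_(z <- s | Q z) G z.
Proof.
elim: s => [|a s IH] PQ G0; first by rewrite !big_nil.
rewrite !big_cons.
have {}IH := IH (fun z zs => PQ z (mem_behead (s := a :: s) zs))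
  (fun z zs => G0 z (mem_behead (s := a :: s) zs)).
have PQa := PQ a (mem_head _ _); have G0a := G0 a (mem_head _ _).
case: ifP => Pa; first by have [-> FG] := PQa Pa; exact: lerD.
by case: ifP => Qa //; rewrite -[leLHS]add0r lerD // G0a.
Qed.

Lemma ler_sum_uniq_sub (s t : seq nat) (P : pred nat) (F : nat -> R) : uniq s ->
  (forall z, z \in s -> z \in t /\ P z) -> uniq t ->
  (forall z, z \in t -> 0 <= F z) ->
  \sum_(z <- s) F z <= \sum_(z <- t | P z) F z.
Proof.
move=> us st ut F0.
rewrite (perm_big [seq z <- t | z \in s]) /=; last first.
  apply: uniq_perm; rewrite ?filter_uniq // => z; rewrite mem_filter.
  by case: (boolP (z \in s)) => //= /st[].
rewrite big_filter; apply: ler_sum_seq_sub => z zt; last by move=> _; exact: F0.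
by move=> /st[].
Qed.

Lemma sum_nbr_le (B : seq nat) (y : nat) (K : R) (F : nat -> R) : uniq B ->
  (forall z, adj c y z -> F z <= K) -> 0 <= K ->
  \sum_(z <- B | adj c y z) F z <= 25 * K.
Proof.
move=> uB FK K0; apply: (@le_trans _ _ (\sum_(z <- B | adj c y z) K)).
  exact: ler_sum.
rewrite big_const_seq iter_addr_0 -[leLHS]mulr_natl ler_wpM2r // ler_nat.
have [N [uN N25 NP]] := nbr_seq pen y; apply: leq_trans N25.
rewrite -size_filter; apply: uniq_leq_size; first exact: filter_uniq.
by move=> z; rewrite mem_filter => /andP[h _]; apply/NP.
Qed.

(* Test the equation against [g^2 / f] and symmetrize: pointwise,
   [(a - b) (p^2 / a - q^2 / b) = (p - q)^2 - (p b - q a)^2 / (a b)]. *)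
Lemma log_caccioppoli (B : seq nat) (f g : nat -> R) :
  (forall y, y \in B -> 0 < f y) ->
  (forall y, y \in B -> g y != 0 ->
     \sum_(z <- B | adj c y z) (f z - f y) = 0) ->
  \sum_(y <- B) \sum_(z <- B | adj c y z)
     (g y * f z - g z * f y) ^+ 2 / (f y * f z) =
  \sum_(y <- B) \sum_(z <- B | adj c y z) (g y - g z) ^+ 2.
Proof.
move=> fpos harm.
pose F y z := g y ^+ 2 / f y * (f z - f y).
have S1 : \sum_(y <- B) \sum_(z <- B | adj c y z) F y z = 0.
  apply: big1_seq => y /andP[_ yB]; rewrite -mulr_sumr.
  have [->|gy] := eqVneq (g y) 0; first by rewrite expr0n mul0r mul0r.
  by rewrite harm // mulr0.
have S2 : \sum_(y <- B) \sum_(z <- B | adj c y z) F z y = 0.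
  rewrite -[RHS]S1 (exchange_big_dep xpredT) //=.
  by apply: eq_bigr => y _; apply: eq_bigl => z; rewrite adjC.
transitivity (\sum_(y <- B) \sum_(z <- B | adj c y z) (g y - g z) ^+ 2 +
  (\sum_(y <- B) \sum_(z <- B | adj c y z) F y z +
   \sum_(y <- B) \sum_(z <- B | adj c y z) F z y)); last first.
  by rewrite S1 S2 !addr0.
rewrite -!big_split /=.
apply: eq_big_seq => y yB.
rewrite -!big_split /= big_seq_cond [RHS]big_seq_cond.
apply: eq_bigr => z /andP[zB _].
have fy : f y != 0 by rewrite gt_eqF ?fpos.
have fz : f z != 0 by rewrite gt_eqF ?fpos.
by rewrite /F; field; rewrite fy fz.
Qed.

(** For positive [f] this is [2 sinh (|log f y - log f z| / 2)], the square root of the edge term in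
    [log_caccioppoli] where the cutoff is 1. *)
Definition log_gap (f : nat -> R) (y z : nat) : R :=
  Num.sqrt ((f y - f z) ^+ 2 / (f y * f z)).

Lemma log_gap_sqr f y z : 0 < f y -> 0 < f z ->
  log_gap f y z ^+ 2 = (f y - f z) ^+ 2 / (f y * f z).
Proof.
by move=> fy fz; rewrite sqr_sqrtr // divr_ge0 ?sqr_ge0 // mulr_ge0 // ltW.
Qed.

(** For [t = sqrt (f y / f z) > 1] the gap is [d = t - 1 / t], so [t <= 1 + d <= exp d]. *)
Lemma log_gap_harnack f y z : 0 < f y -> 0 < f z ->
  f y <= f z * expR (2 * log_gap f y z).
Proof.
move=> fy fz; have d0 : 0 <= log_gap f y z by exact: sqrtr_ge0.
have dd := log_gap_sqr fy fz; set d := log_gap f y z in d0 dd *.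
have [yz|zy] := lerP (f y) (f z).
  apply: (le_trans yz); apply: ler_peMr; first exact: ltW.
  by rewrite -[leLHS]expR0 ler_expR; lra.
pose t := Num.sqrt (f y / f z).
have t2 : t ^+ 2 = f y / f z by rewrite sqr_sqrtr // divr_ge0 // ltW.
have t0 : 0 < t by rewrite sqrtr_gt0 divr_gt0.
have t1 : 1 < t ^+ 2 by rewrite t2 ltr_pdivlMr // mul1r.
have fyE : f y = t ^+ 2 * f z by rewrite t2 divfK // gt_eqF.
have e : t ^+ 2 - 1 = d * t.
  apply/eqP; rewrite -(@eqrXn2 _ 2) //; [|lra|exact: mulr_ge0 (ltW t0)].
  rewrite exprMn dd fyE; apply/eqP; field; rewrite !gt_eqF //.
have td : t <= 1 + d by rewrite expr2 in e; nra.
rewrite fyE mulrC ler_pM2l // expRM_natl.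
rewrite ler_pXn2r ?nnegrE ?expR_ge0 ?(ltW t0) //.
exact: le_trans td (expR_ge1Dx d).
Qed.

(** The gap of each edge of the path is one term of the sum at its starting vertex. *)
Lemma path_harnack (B : seq nat) f u s :
  (forall y, y \in B -> 0 < f y) ->
  path (adj c) u s -> (forall w, w \in u :: s -> w \in B) ->
  f u <= f (last u s) * expR (2 * \sum_(y <- u :: s)
    \sum_(z <- B | adj c y z) log_gap f y z).
Proof.
move=> fpos; pose E y := \sum_(z <- B | adj c y z) log_gap f y z.
have E0 y : 0 <= E y by apply: sumr_ge0 => z _; exact: sqrtr_ge0.
rewrite -/(E _); elim: s u => [|v s IH] u /= => [_|/andP[uv vs]] sB.
  have fu : 0 < f u by apply: fpos; apply: sB; rewrite mem_head.
  rewrite big_seq1; apply: ler_peMr; first exact: ltW.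
  by rewrite -[leLHS]expR0 ler_expR mulr_ge0 //; exact: E0.
have uB : u \in B by apply: sB; rewrite mem_head.
have vB : v \in B by apply: sB; rewrite !inE eqxx orbT.
have {}IH := IH v vs (fun w ws => sB w (mem_behead (s := u :: v :: s) ws)).
rewrite big_cons mulrDr expRD mulrCA.
have uvE : log_gap f u v <= E u.
  rewrite /E big_mkcond /= (big_rem v) //= uv lerDl.
  by apply: sumr_ge0 => z _; case: ifP => // _; exact: sqrtr_ge0.
apply: le_trans (log_gap_harnack (fpos _ uB) (fpos _ vB)) _.
rewrite mulrC ler_pM ?expR_ge0 ?(ltW (fpos _ vB)) // ler_expR.
by rewrite ler_pM2l.
Qed.

Definition clamp (a : R) : R := Num.max 0 (Num.min 1 a).

Lemma clampP a : [\/ a <= 0 /\ clamp a = 0, [/\ 0 <= a, a <= 1 & clamp a = a] |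
  1 <= a /\ clamp a = 1].
Proof.
have [a1|a1] := leP 1 a.
  by apply: Or33; split=> //; rewrite /clamp min_l // max_r.
have [a0|a0] := leP a 0.
  by apply: Or31; split=> //; rewrite /clamp min_r ?(ltW a1) // max_l.
by apply: Or32; rewrite /clamp min_r ?(ltW a1) // max_r ?ltW.
Qed.

Lemma clamp_lipschitz a b e : `|a - b| <= e -> `|clamp a - clamp b| <= e.
Proof.
move=> /ler_normlP[h1 h2]; apply/ler_normlP.
by case: (clampP a) => [[? ->]|[? ? ->]|[? ->]]; case: (clampP b) =>
  [[? ->]|[? ? ->]|[? ->]]; split; lra.
Qed.

End LogEnergy.

(** * Harnack inequality on squares *)

Section SquareHarnack.
Variables (R : realType) (c : nat -> R * R) (D : nat).
Hypothesis pen : is_penny c.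
Hypothesis conn : graph_connected c.
Hypothesis deg : forall S, faces c S -> (facial_degree c S <= D%:R%:E)%E.

Lemma exists_le_average (m : nat) (F : 'I_m -> R) (a : R) : (0 < m)%N ->
  \sum_(i < m) F i <= m%:R * a -> exists i, F i <= a.
Proof.
case: m F => // m F _ h; apply: contrapT => no.
have lt i : a < F i by rewrite ltNge; apply/negP => h'; apply: no; exists i.
move: h; rewrite big_ord_recl leNgt => /negP; apply.
have : \sum_(i < m) a <= \sum_(i < m) F (lift ord0 i).
  by apply: ler_sum => i _; exact: ltW.
rewrite sumr_const card_ord -mulr_natl => h.
by have := lt ord0; rewrite -natr1; lra.
Qed.

Lemma laplacian_opp (f : nat -> R) y :
  laplacian c f y = 0 -> laplacian c (fun z => - f z) y = 0.
Proof.
have [N [uN _ NP]] := nbr_seq pen y.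
have yN z : adj c y z -> z \in N by move=> /NP.
rewrite !(laplacian_seq _ uN yN) => h; rewrite -[RHS]oppr0 -[in RHS]h -sumrN.
by apply: eq_bigr => z _; ring.
Qed.

(** At most [(21 n)^2] vertices with at most 25 neighbors each contribute [n^-2] per edge; the
    powers of [n] cancel in dimension two. *)
Lemma energy_bound (B : seq nat) (n : nat) (g : nat -> R) : (0 < n)%N ->
  uniq B -> (size B <= (21 * n) ^ 2)%N ->
  (forall y z, adj c y z -> `|g y - g z| <= n%:R^-1) ->
  \sum_(y <- B) \sum_(z <- B | adj c y z) (g y - g z) ^+ 2 <= 25 * 21 ^+ 2.
Proof.
move=> n0 uB sB lip; have n0' : 0 < n%:R :> R by rewrite ltr0n.
apply: (@le_trans _ _ (\sum_(y <- B) (25 * (n%:R^-1 ^+ 2)))).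
  apply: ler_sum => y _; apply: sum_nbr_le; rewrite ?sqr_ge0 //.
  move=> z /lip h; rewrite -real_normK ?num_real // ler_pXn2r ?nnegrE //.
rewrite big_const_seq iter_addr_0 count_predT -[leLHS]mulr_natl.
have sB' : (size B)%:R <= (21 * n%:R) ^+ 2 :> R.
  by rewrite -natrM -natrX ler_nat.
apply: (@le_trans _ _ ((21 * n%:R) ^+ 2 * (25 * (n%:R^-1 ^+ 2)))).
  by apply: ler_wpM2r => //; rewrite mulr_ge0 ?sqr_ge0.
by rewrite le_eqVlt; apply/orP; left; apply/eqP; field; rewrite gt_eqF.
Qed.

Definition cutoff (x n y : nat) : R := clamp (4 - `|c y - c x| / n%:R).

Lemma cutoff_lipschitz x n y z : (0 < n)%N -> adj c y z ->
  `|cutoff x n y - cutoff x n z| <= n%:R^-1.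
Proof.
move=> n0 yz; have n0' : 0 < n%:R :> R by rewrite ltr0n.
apply: clamp_lipschitz.
have -> : 4 - `|c y - c x| / n%:R - (4 - `|c z - c x| / n%:R) =
    (`|c z - c x| - `|c y - c x|) / n%:R :> R by ring.
rewrite normrM normfV (gtr0_norm n0') -[leRHS]mul1r.
apply: ler_wpM2r; first by rewrite invr_ge0 ltW.
have := ler_distD (c z) (c y) (c x); have := ler_distD (c y) (c z) (c x).
have := adj_norm yz; rewrite (distrC (c z) (c y)) => ? ? ?.
by apply/ler_normlP; split; lra.
Qed.

Lemma cutoff1 x n y : (0 < n)%N -> `|c y - c x| <= 3 * n%:R -> cutoff x n y = 1.
Proof.
move=> n0 yx; have n0' : 0 < n%:R :> R by rewrite ltr0n.
have : `|c y - c x| / n%:R <= 3 by rewrite ler_pdivrMr.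
rewrite /cutoff => h.
by case: (clampP (4 - `|c y - c x| / n%:R)) => [[? ->]|[? ? ->]|[]] //; lra.
Qed.

Lemma cutoff0 x n y : (0 < n)%N -> 4 * n%:R <= `|c y - c x| -> cutoff x n y = 0.
Proof.
move=> n0 yx; have n0' : 0 < n%:R :> R by rewrite ltr0n.
have : 4 <= `|c y - c x| / n%:R by rewrite ler_pdivlMr.
rewrite /cutoff => h.
by case: (clampP (4 - `|c y - c x| / n%:R)) => [[]|[? ? ->]|[? ->]] //; lra.
Qed.

(** Used in place of the Cauchy-Schwarz inequality, to pass from a sum of squares to a sum. *)
Lemma le_sqr_scaled (a n : R) : 0 < n -> a <= n * a ^+ 2 + n^-1.
Proof.
move=> n0; have -> : n^-1 = n * (n^-1 ^+ 2) by field; rewrite gt_eqF.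
have {1}-> : a = n * (a * n^-1) by field; rewrite gt_eqF.
rewrite -mulrDr ler_pM2l //.
have := sqr_ge0 (a - n^-1); have := sqr_ge0 (a + n^-1).
by move: (n^-1) => e; rewrite !expr2; lra.
Qed.

(** The first term comes from the energy, the second from counting edges in the square of radius
    [3 n]. *)
Definition gap_bound : R := 25 * 21 ^+ 2 + 25 * 13 ^+ 2.

Lemma log_gap_total (x n : nat) (f : nat -> R) (B : seq nat) : (0 < n)%N ->
  (forall y, `|c y - c x| <= 5 * n%:R -> laplacian c f y = 0 /\ 0 < f y) ->
  uniq B -> (forall y, y \in B -> `|c y - c x| <= 3 * n%:R) ->
  \sum_(y <- B) \sum_(z <- B | adj c y z) log_gap f y z <= gap_bound * n%:R.
Proof.
move=> n0 harm uB B3; have n0' : 0 < n%:R :> R by rewrite ltr0n.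
have n1 : 1 <= n%:R :> R by rewrite ler1n.
(* The cutoff vanishes from [4 n] on, so the square of radius [5 n] contains all neighbors of the
   vertices where it does not. *)
have [B5 uB5 B5P] := ball_seq pen (c x) (5 * n).
have {}B5P y : y \in B5 <-> `|c y - c x| <= 5 * n%:R by rewrite B5P natrM.
have sB5 : (size B5 <= (21 * n) ^ 2)%N.
  apply: leq_trans (@packing _ _ pen (c x) (5 * n) B5 uB5 _) _.
    by move=> y /B5P; rewrite natrM.
  by rewrite leq_exp2r //; lia.
have sB : (size B <= (13 * n) ^ 2)%N.
  apply: leq_trans (@packing _ _ pen (c x) (3 * n) B uB _) _.
    by move=> y /B3; rewrite natrM.
  by rewrite leq_exp2r //; lia.
have BB5 y : y \in B -> y \in B5 by move=> /B3 h; apply/B5P; lra.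
have pos5 y : y \in B5 -> 0 < f y by move=> /B5P/harm[].
have cacc := @log_caccioppoli _ _ B5 f (cutoff x n) pos5.
have {}cacc : \sum_(y <- B5) \sum_(z <- B5 | adj c y z)
     (cutoff x n y * f z - cutoff x n z * f y) ^+ 2 / (f y * f z) <=
     25 * 21 ^+ 2.
  rewrite cacc; first by apply: (energy_bound n0 uB5 sB5) => y z yz;
    exact: cutoff_lipschitz n0 yz.
  move=> y /B5P y5 gy.
  have y4 : `|c y - c x| < 4 * n%:R.
    by rewrite ltNge; apply/negP => /(cutoff0 n0) /eqP; rewrite (negbTE gy).
  rewrite -(@laplacian_seq _ _ f y B5 uB5); first by case: (harm y y5).
  move=> z yz; apply/B5P; have := ler_distD (c y) (c z) (c x).
  by have := adj_norm yz; rewrite (distrC (c y) (c z)); lra.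
have sq : \sum_(y <- B) \sum_(z <- B | adj c y z) log_gap f y z ^+ 2 <=
    25 * 21 ^+ 2.
  apply: le_trans cacc.
  have t0 y z : y \in B5 -> z \in B5 ->
      0 <= (cutoff x n y * f z - cutoff x n z * f y) ^+ 2 / (f y * f z).
    by move=> /pos5 fy /pos5 fz; rewrite divr_ge0 ?sqr_ge0 // mulr_ge0 // ltW.
  have s0 y : y \in B5 -> 0 <= \sum_(z <- B5 | adj c y z)
      (cutoff x n y * f z - cutoff x n z * f y) ^+ 2 / (f y * f z).
    move=> y5; rewrite big_seq_cond; apply: sumr_ge0 => z /andP[z5 _].
    exact: t0.
  apply: le_trans (@ler_sum_uniq_sub _ B B5 xpredT _ uB _ uB5 s0); last first.
    by move=> y /BB5.
  rewrite big_seq [leRHS]big_seq; apply: ler_sum => y yB.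
  rewrite -big_filter.
  apply: le_trans (@ler_sum_uniq_sub _ [seq z <- B | adj c y z] B5
    (adj c y) _ _ _ uB5 _).
  - rewrite big_seq [leRHS]big_seq; apply: ler_sum => z.
    rewrite mem_filter => /andP[_ zB].
    rewrite log_gap_sqr ?pos5 ?BB5 // !cutoff1 ?B3 // !mul1r.
    by rewrite -sqrrN opprB.
  - exact: filter_uniq.
  - by move=> z; rewrite mem_filter => /andP[-> /BB5].
  - by move=> z z5; apply: t0 => //; exact: BB5.
apply: (@le_trans _ _ (\sum_(y <- B) (n%:R *
   (\sum_(z <- B | adj c y z) log_gap f y z ^+ 2) + 25 * n%:R^-1))).
  apply: ler_sum => y _.
  apply: le_trans (ler_sum _ (fun z _ => le_sqr_scaled _ n0')) _.
  rewrite big_split /= -mulr_sumr lerD2l.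
  by apply: sum_nbr_le => //; rewrite invr_ge0 ltW.
rewrite big_split /= -mulr_sumr big_const_seq iter_addr_0 count_predT.
rewrite -[X in _ + X]mulr_natl.
have sB' : (size B)%:R <= (13 * n%:R) ^+ 2 :> R.
  by rewrite -natrM -natrX ler_nat.
have h1 : n%:R * \sum_(y <- B) \sum_(z <- B | adj c y z) log_gap f y z ^+ 2 <=
   n%:R * (25 * 21 ^+ 2) by rewrite ler_pM2l.
have h2 : (size B)%:R * (25 * n%:R^-1) <=
    (13 * n%:R) ^+ 2 * (25 * n%:R^-1) :> R.
  by apply: ler_wpM2r => //; rewrite mulr_ge0 // invr_ge0 ltW.
have h3 : (13 * n%:R) ^+ 2 * (25 * n%:R^-1) = n%:R * (25 * 13 ^+ 2) :> R.
  by field; rewrite gt_eqF.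
rewrite h3 in h2; apply: le_trans (lerD h1 h2) _.
by rewrite -mulrDr mulrC.
Qed.

Lemma square_harnack (P m x : nat) (f : nat -> R) (u v : nat) :
  2 * (2 * reach R D + 1) < P%:R -> (0 < m)%N ->
  (forall y, `|c y - c x| <= 5 * (m * P)%:R ->
     laplacian c f y = 0 /\ 0 < f y) ->
  `|c u - c x| < (m * P)%:R -> `|c v - c x| < (m * P)%:R ->
  f u <= f v * expR (2 * (gap_bound * P%:R)).
Proof.
have [K [KE K0]] : exists K, K = 2 * reach R D + 1 /\ 0 <= K.
  by exists (2 * reach R D + 1); split=> //; have := reach_ge2 R D; lra.
have [n nE] : exists n, n = (m * P)%N by exists (m * P)%N.
rewrite -KE -!nE => KP m0 harm un vn.
have n0' : 0 < n%:R :> R by apply: le_lt_trans un.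
have n0 : (0 < n)%N by rewrite -(ltr0n R).
have [B uB BP] := ball_seq pen (c x) (3 * n).
have {}BP y : y \in B <-> `|c y - c x| <= 3 * n%:R by rewrite BP natrM.
pose E y := \sum_(z <- B | adj c y z) log_gap f y z.
have E0 y : 0 <= E y by apply: sumr_ge0 => z _; exact: sqrtr_ge0.
have total : \sum_(y <- B) E y <= gap_bound * n%:R.
  by apply: log_gap_total n0 harm uB _ => y /BP.
(* The spacing [P] exceeds [2 K], so these [m] frames are disjoint. *)
pose r (i : 'I_m) : R := n%:R + i%:R * P%:R.
pose A (i : 'I_m) (y : nat) := r i - K <= `|c y - c x| <= r i + K.
have disj (i j : 'I_m) y : (i < j)%N -> A i y -> A j y -> False.
  move=> ij /andP[_ h1] /andP[h2 _].
  have : (i.+1%:R * P%:R : R) <= j%:R * P%:R.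
    by rewrite ler_wpM2r // ler_nat.
  by move: h1 h2; rewrite /r -natr1 mulrDl mul1r; lra.
(* The total over the [m] disjoint frames is at most [gap_bound * m * P], so one of them gets at
   most the average. *)
have [i Ai] : exists i, \sum_(y <- B | A i y) E y <= gap_bound * P%:R.
  apply: exists_le_average => //.
  apply: (@le_trans _ _ (\sum_(y <- B) E y)); last first.
    by apply: le_trans total _; rewrite nE natrM mulrCA.
  rewrite (exchange_big_dep xpredT) //=; apply: ler_sum => y _.
  case: (pickP (fun i : 'I_m => A i y)) => [i0 Ai0|none]; last first.
    by rewrite big_pred0.
  rewrite (bigD1 i0) //= big_pred0 ?addr0 // => j.
  apply/negbTE/negP => /andP[Aj]; rewrite neq_ltn => /orP[h|h].
    exact: disj h Aj Ai0.
  exact: disj h Ai0 Aj.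
have i0 : 0 <= i%:R * P%:R :> R by rewrite mulr_ge0.
have in1 : (i%:R + 1) * P%:R <= n%:R :> R.
  by rewrite natr1 -natrM ler_nat nE leq_mul2r ltn_ord orbT.
have rn : n%:R <= r i by rewrite /r; lra.
have r2n : r i + K <= 3 * n%:R by rewrite /r; lra.
have harm_r y : `|c y - c x| < r i -> laplacian c f y = 0.
  by move=> yr; case: (harm y _) => //; lra.
(* Applied to [f] from [u] and to [- f] from [v], this gives vertices of the frame with
   [f u <= f u'] and [f v' <= f v]. *)
have [u' [u1 u2 fu]] := maximum_principle pen conn harm_r (lt_le_trans un rn).
have [v' [v1 v2 fv]] := maximum_principle pen conn
  (fun y yr => laplacian_opp (harm_r y yr)) (lt_le_trans vn rn).
have r0 : 0 <= r i by rewrite /r; lra.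
have [s [us sv un' sA]] := annulus_joined pen conn deg r0 u1 u2 v1 v2.
rewrite -KE in sA.
have sB w : w \in u' :: s -> w \in B.
  by move=> /sA/andP[_ h]; apply/BP; apply: le_trans r2n.
have pos y : y \in B -> 0 < f y.
  by move=> /BP h; case: (harm y _) => //; lra.
have := path_harnack pos us sB; rewrite sv => h.
have sE : \sum_(y <- u' :: s) E y <= \sum_(y <- B | A i y) E y.
  apply: (@ler_sum_uniq_sub R (u' :: s) B (A i) E) => // w ws.
  by split; [exact: sB|exact: sA].
apply: (le_trans fu); apply: (le_trans h).
rewrite lerN2 in fv.
have fv0 : 0 < f v by case: (harm v _) => //; lra.
rewrite ler_pM ?expR_ge0 //; first by rewrite ltW // pos // -sv sB // mem_last.
by rewrite ler_expR ler_pM2l //; apply: le_trans sE Ai.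
Qed.

End SquareHarnack.

(** * Harnack inequality on graph balls *)

Section GraphBalls.
Variables (R : realType) (c : nat -> R * R).
Hypothesis pen : is_penny c.
Hypothesis conn : graph_connected c.

Lemma gballP x (r : R) y : gball c x r y <->
  exists s, [/\ path (adj c) y s, last y s = x & (size s)%:R <= r].
Proof.
rewrite /gball /= /gdist; split=> [h|[s [ys sx sr]]]; last first.
  apply: le_trans (_ : (size s)%:R%:E <= r%:E)%E; last by rewrite lee_fin.
  by apply: ereal_inf_lbound; exists (size s) => //; exists s.
(* Lengths are natural numbers, so an infimum at most [r] yields a walk shorter than
   [(Num.truncn r).+1]; for negative [r] the ball is empty. *)
have [r0|r0] := leP 0 r.
  have /andP[t1 t2] := truncn_itv r0.
  have /ereal_inf_lt[_ [n [s [ys sx <-]] <-]] : (ereal_inf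
      [set (n%:R : R)%:E | n in walk_of_length c y x] <
      (Num.truncn r).+1%:R%:E)%E by apply: le_lt_trans h _; rewrite lte_fin.
  rewrite lte_fin ltr_nat ltnS => sr; exists s; split=> //.
  by apply: le_trans t1; rewrite ler_nat.
have /ereal_inf_lt[_ [n _ <-]] : (ereal_inf
    [set (n%:R : R)%:E | n in walk_of_length c y x] < 0)%E.
  by apply: le_lt_trans h _; rewrite lte_fin.
by rewrite lte_fin ltrn0.
Qed.

Lemma gball_path x (r : R) u s : path (adj c) u s -> last u s = x ->
  (size s)%:R <= r -> forall w, w \in u :: s -> gball c x r w.
Proof.
elim: s u => [|a s IH] u /=.
  move=> _ ux r0 w; rewrite inE => /eqP ->; apply/gballP.
  by exists [::].
move=> /andP[ua us] sx sr w; rewrite inE => /orP[/eqP ->|ws].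
  by apply/gballP; exists (a :: s); rewrite /= ua.
by apply: (IH a) => //; apply: le_trans sr; rewrite ler_nat.
Qed.

Lemma chain_harnack (f : nat -> R) (G : set nat) (k : nat) (C : R) : 0 <= C ->
  (forall a s, path (adj c) a s -> (size s <= k)%N ->
     (forall w, w \in a :: s -> G w) ->
     f a <= C * f (last a s) /\ f (last a s) <= C * f a) ->
  forall q a s, path (adj c) a s -> (size s <= q.+1 * k)%N ->
     (forall w, w \in a :: s -> G w) ->
     f a <= C ^+ q.+1 * f (last a s) /\ f (last a s) <= C ^+ q.+1 * f a.
Proof.
move=> C0 loc; elim=> [|q IH] a s as_ sq sG.
  by rewrite !expr1; apply: loc; rewrite // -[k]mul1n.
move: as_ sG; rewrite -(cat_take_drop k s) cat_path last_cat -cat_cons.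
set t := take k s; set b := last a t; set t' := drop k s => /andP[at_ bt] sG.
have [h1 h2] : f a <= C * f b /\ f b <= C * f a.
  apply: loc => // [|w wt]; first by rewrite size_take_min geq_minl.
  by apply: sG; rewrite mem_cat wt.
have [h3 h4] : f b <= C ^+ q.+1 * f (last b t') /\
    f (last b t') <= C ^+ q.+1 * f b.
  apply: IH => // [|w]; first by rewrite size_drop leq_subLR -mulSn.
  rewrite inE => /orP[/eqP ->|wt]; apply: sG; rewrite mem_cat.
    by rewrite mem_last.
  by rewrite wt orbT.
split; first by apply: (le_trans h1); rewrite [C ^+ q.+2]exprS -mulrA ler_wpM2l.
apply: (le_trans h4); rewrite [C ^+ q.+2]exprSr -mulrA ler_wpM2l //.
exact: exprn_ge0.
Qed.

(** [f b] is one of the nonnegative terms whose sum is the degree of [a] times [f a]. *)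
Lemma neighbor_harnack (f : nat -> R) a b : adj c a b ->
  laplacian c f a = 0 -> 0 <= f a -> (forall z, adj c a z -> 0 <= f z) ->
  f b <= 25 * f a.
Proof.
move=> ab; have [N [uN _ NP]] := nbr_seq pen a.
have aN z : adj c a z -> z \in N by move=> /NP.
rewrite (laplacian_seq _ uN aN) => h fa fN.
apply: (@le_trans _ _ (\sum_(z <- N | adj c a z) f z)).
  rewrite big_mkcond (big_rem b) ?aN //= ab lerDl.
  by apply: sumr_ge0 => z _; case: ifP => // /fN.
have -> : \sum_(z <- N | adj c a z) f z = \sum_(z <- N | adj c a z) f a.
  by apply/eqP; rewrite -subr_eq0 -sumrB h.
exact: sum_nbr_le.
Qed.

End GraphBalls.

(** For small [r], boundedly many edges are followed with [neighbor_harnack]. For large [r], squares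
    of radius [n] comparable to [r] fit into the ball of radius [2 r], and boundedly many
    applications of [square_harnack] suffice. *)
Lemma harnack_at_scale (R : realType) (c : nat -> R * R) (D : nat) (x : nat)
    (r : R) (f : nat -> R) :
  is_penny c -> graph_connected c ->
  (forall S, faces c S -> (facial_degree c S <= D%:R%:E)%E) ->
  forall P, 2 * (2 * reach R D + 1) < P%:R :> R -> 1 <= r ->
  positive_harmonic c (gball c x (2 * r)) f ->
  forall y z, gball c x r y -> gball c x r z ->
  f y <= (25 + expR (2 * (gap_bound R * P%:R))) ^+
    (48 * stretch D * P) * f z.
Proof.
move=> pen conn deg P KP r1 harm.
have [M ME] : exists M, M = stretch D by exists (stretch D).
rewrite -ME; pose C1 : R := 25 + expR (2 * (gap_bound R * P%:R)).
have M0 : (0 < M)%N by rewrite ME /stretch expn_gt0 addn_gt0 orbT.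
have MR : 1 <= M%:R :> R by rewrite ler1n.
have P1 : (1 < P)%N.
  by rewrite -(ltr_nat R); have := reach_ge2 R D; lra.
have PR : 2 <= P%:R :> R by rewrite ler_nat.
have e0 : 0 <= expR (2 * (gap_bound R * P%:R)) by exact: expR_ge0.
have C25 : 25 <= C1 by rewrite /C1; lra.
have C0 : 0 <= C1 by lra.
have r2 y : gball c x r y -> gball c x (2 * r) y.
  by move=> /gballP[s [? ? ?]]; apply/gballP; exists s; split=> //; lra.
have pos y : gball c x r y -> 0 < f y by move=> /r2/harm[].
(* [Q] dominates both the [6 M P] edges of the first regime and the [24 M] pieces of the second;
   comparing through the center [x] doubles it. *)
pose Q := (24 * M * P)%N.
suff H : forall y, gball c x r y ->
  f y <= C1 ^+ Q * f x /\ f x <= C1 ^+ Q * f y.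
  move=> y z /H[h _] /H[_ h']; apply: (le_trans h).
  rewrite (_ : 48 * M * P = Q + Q)%N; last by rewrite /Q; lia.
  by rewrite exprD -mulrA ler_wpM2l // exprn_ge0.
have weaken q a b : 0 <= b -> (q <= Q)%N -> a <= C1 ^+ q * b ->
    a <= C1 ^+ Q * b.
  move=> b0 qQ h; apply: (le_trans h); rewrite ler_wpM2r //.
  by apply: ler_weXn2l qQ; lra.
have conclude k q : (0 < q)%N -> (q <= Q)%N -> r <= (q * k)%:R ->
    (forall a s, path (adj c) a s -> (size s <= k)%N ->
     (forall w, w \in a :: s -> gball c x r w) ->
     f a <= C1 * f (last a s) /\ f (last a s) <= C1 * f a) ->
    forall y, gball c x r y -> f y <= C1 ^+ Q * f x /\ f x <= C1 ^+ Q * f y.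
  case: q => // q _ qQ rqk loc y yr.
  have xr : gball c x r x by apply/gballP; exists [::]; split=> //=; lra.
  have [s [ys sx sr]] := (gballP c x r y).1 yr.
  have [|h1 h2] := chain_harnack C0 loc (q := q) ys _ (gball_path ys sx sr).
    by rewrite -(ler_nat R); apply: le_trans rqk.
  rewrite sx in h1 h2.
  by split; [move: h1|move: h2]; apply: weaken => //; rewrite ltW // pos.
have MP0 : 0 < (6 * M * P)%:R :> R by rewrite ltr0n !muln_gt0 M0 /= ltnW.
have [big|small] := leP (6 * M * P)%:R r; last first.
  apply: (@conclude 1 (6 * M * P)%N).
  - by rewrite -(ltr0n R).
  - by rewrite /Q; lia.
  - by rewrite muln1 ltW.
  move=> a [|b [|//]] /=.
    move=> _ _ sG; have fa : 0 < f a by apply: pos; apply: sG; rewrite mem_head.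
    by split; rewrite ler_peMl ?ltW //; lra.
  rewrite andbT => ab _ sG.
  have nbr u v : adj c u v -> gball c x r u -> f v <= C1 * f u.
    move=> uv ur; have [lu fu] := harm u (r2 _ ur).
    apply: (@le_trans _ _ (25 * f u)); last by rewrite ler_wpM2r // ltW.
    apply: neighbor_harnack uv lu (ltW fu) _ => // z uz.
    have /gballP[s [us sx sr]] := ur.
    suff /harm[_ /ltW] : gball c x (2 * r) z by [].
    apply/gballP; exists (u :: s); split; rewrite //= ?us 1?adjC ?uz //.
    by rewrite -natr1; lra.
  have ar : gball c x r a by apply: sG; rewrite mem_head.
  have br : gball c x r b by apply: sG; rewrite !inE eqxx orbT.
  by split; apply: nbr; rewrite // adjC.
pose m := Num.truncn (r / (6 * M * P)%:R).
have /andP[m1 m2] : m%:R <= r / (6 * M * P)%:R < m.+1%:R.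
  by apply: truncn_itv; rewrite divr_ge0 //; lra.
rewrite ler_pdivlMr // in m1; rewrite ltr_pdivrMr // in m2.
rewrite -natrM in m1; rewrite -natrM in m2.
have m0 : (0 < m)%N.
  rewrite lt0n; apply/eqP => m0; move: m2; rewrite m0 mul1n; lra.
pose n := (m * P)%N.
have n2 : (2 <= n)%N by rewrite -[2%N]mul1n leq_mul.
(* Pieces have length at most [n - 1] because [square_harnack] needs distances strictly below [n].
   They suffice since [r <= 12 M n] and [n <= 2 (n - 1)]. *)
apply: (@conclude n.-1 (24 * M)%N).
- by rewrite muln_gt0.
- by rewrite /Q leq_pmulr // ltnW.
- apply: le_trans (ltW m2) _; rewrite ler_nat.
  apply: (@leq_trans ((6 * M * P) * (m + m))%N).
    by rewrite mulnC leq_mul2l; apply/orP; right; clear -m0; lia.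
  rewrite (_ : 6 * M * P * (m + m) = 12 * M * n)%N; last by rewrite /n; ring.
  rewrite (_ : 24 * M * n.-1 = 12 * M * (n.-1 + n.-1))%N; last by ring.
  by rewrite leq_mul2l; apply/orP; right; clear -n2; lia.
move=> a s as_ sk sG.
have ar : gball c x r a by apply: sG; rewrite mem_head.
(* Sup distance [5 n] costs at most [M (5 n + 1) <= 6 M n <= r] steps in the graph, so the square
   stays in the ball of radius [2 r] about [x]. *)
have harm_a y : `|c y - c a| <= 5 * n%:R -> laplacian c f y = 0 /\ 0 < f y.
  rewrite -natrM => ya; apply: harm.
  have [t [yt ta tM]] := walk_linear_bound pen conn deg ya.
  have /gballP[t' [at' t'x t'r]] := ar.
  apply/gballP; exists (t ++ t'); rewrite cat_path last_cat ta yt; split=> //.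
  rewrite size_cat natrD.
  have : (size t)%:R <= r.
    apply: le_trans m1; rewrite ler_nat; apply: (leq_trans tM).
    rewrite -ME (_ : m * (6 * M * P) = M * (6 * n))%N; last by rewrite /n; ring.
    by rewrite leq_mul2l; apply/orP; right; clear -n2; lia.
  lra.
have n0 : 0 < n%:R :> R by rewrite ltr0n ltnW.
have aa : `|c a - c a| < n%:R by rewrite subrr normr0.
have la : `|c (last a s) - c a| < n%:R.
  rewrite distrC; apply: le_lt_trans (path_norm as_) _.
  by rewrite ltr_nat; clear -n2 sk; lia.
have fa : 0 < f a by apply: pos.
have fl : 0 < f (last a s) by apply: pos; apply: sG; exact: mem_last.
have h1 := square_harnack pen conn deg KP m0 harm_a aa la.
have h2 := square_harnack pen conn deg KP m0 harm_a la aa.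
by split; [apply: (le_trans h1)|apply: (le_trans h2)];
  rewrite mulrC ler_wpM2r ?ltW //; rewrite /C1; lra.
Qed.

Theorem corollary3p8 (R : realType) (D : nat) :
  exists C : R,
    forall c : nat -> R * R,
      is_penny c ->
      graph_connected c ->
      (forall S : set (R * R), faces c S -> (facial_degree c S <= D%:R%:E)%E) ->
      forall (x : nat) (r : R), 1 <= r ->
      forall f : nat -> R,
        positive_harmonic c (gball c x (2 * r)) f ->
        (ereal_sup [set (f y)%:E | y in gball c x r]
           <= C%:E * ereal_inf [set (f y)%:E | y in gball c x r])%E.
Proof.
(* The spacing of the frames, and with it the constant, depends on [D] only. *)
pose P := (Num.truncn (2 * (2 * reach R D + 1))).+1.
have KP : 2 * (2 * reach R D + 1) < P%:R by exact: truncnS_gt.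
pose C : R := (25 + expR (2 * (gap_bound R * P%:R))) ^+ (48 * stretch D * P).
have C0 : 0 < C by rewrite exprn_gt0 // ltr_wpDr ?expR_ge0.
exists C => c pen conn deg x r r1 f harm.
apply: ge_ereal_sup => _ [y yr <-].
rewrite -lee_pdivrMl //; apply: le_ereal_inf_tmp => _ [z zr <-].
rewrite lee_pdivrMl // -EFinM lee_fin.
exact: (harnack_at_scale pen conn deg KP r1 harm yr zr).
Qed.
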